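(* Let $q$ be a real locally integrable function on $\mathbb{R}$ such that $\mathbb{L}_q=-\partial_x^2+q$ is semibounded below and such that for a.e. real $k$ the right Jost solution $\psi(x,k)$ ($\psi\sim e^{\mathrm{i}kx}$, $\psi'\sim\mathrm{i}ke^{\mathrm{i}kx}$, $x\to+\infty$) exists. Let $D$ be the set of embedded bound states (positive eigenvalues) of $\mathbb{L}_q$ and let $D_0=\{\omega_n^2:1\le n\le N\}\subset D$, $N<\infty$, $\omega_n>0$, be such that each $\omega_n^2$ is a simple eigenvalue and the functions $R(k)$ and $(k-\omega_n)\psi(x,k)$ are continuous in real $k$ at $\omega_n$. Let $\{\phi_n:1\le n\le N\}$ be an orthonormal set in $L^2(\mathbb{R})$ of real eigenfunctions, $\phi_n$ corresponding to $\omega_n^2$. Let $\mathbf{G}_-(x)$ be the $N\times N$ matrix with entries $\int_{-\infty}^x\phi_n(s)\phi_m(s)\,\mathrm{d}s$. Then the set of embedded eigenvalues of the potential $$q_{-N}(x)=q(x)-2\partial_x^2\log\det(\mathbf{I}-\mathbf{G}_-(x))$$ coincides with $D\setminus D_0$.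
   Context: The right reflection coefficient is $R(k)=-W(\varphi(x,k),\overline{\psi(x,k)})/W(\varphi(x,k),\psi(x,k))$ for a.e. real $k$, where $\varphi(x,k)$ is the boundary value on the real axis of the left Weyl solution (the solution of $\mathbb{L}_qu=k^2u$ in $L^2(a,-\infty)$ for $\operatorname{Im}k>0$) and $W(f,g)=fg'-f'g$. *)

(* Defs.v *)
From HB Require Import structures.
From mathcomp Require Import all_boot all_order all_algebra.
From mathcomp Require Import all_classical all_reals all_analysis.
From mathcomp Require Import complex.
Set Implicit Arguments. Unset Strict Implicit. Unset Printing Implicit Defensive.
Import numFieldNormedType.Exports.
Import Order.TTheory GRing.Theory Num.Theory.
Local Open Scope ring_scope.
Local Open Scope classical_set_scope.

Section Defs.
Variable R : realType.
Local Notation mu := (@lebesgue_measure R).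

Definition integ (A : set R) (f : R -> R) : R :=
  fine (\int[mu]_(t in A) (f t)%:E)%E.

Definition loc_integrable (f : R -> R) : Prop :=
  forall a b : R, mu.-integrable `[a, b] (EFin \o f).

Definition sq_int (A : set R) (u : R -> R) : Prop :=
  mu.-integrable A (EFin \o (fun t => u t ^+ 2)).

(* u solves -u'' + q u = f on R (in the Caratheodory sense):
   u is C^1, u' is locally absolutely continuous with u'' = q u - f a.e. *)
Definition ode_sol (q u f : R -> R) : Prop :=
  (forall x, derivable u x 1) /\
  forall a b : R, a <= b ->
    mu.-integrable `[a, b] (EFin \o (fun t => q t * u t - f t)) /\
    derive1 u b - derive1 u a = integ `[a, b] (fun t => q t * u t - f t).

Definition rsol (q : R -> R) (lam : R) (u : R -> R) : Prop :=
  ode_sol q u (fun t => lam * u t).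

(* complex solution u + i v of L_q (u + i v) = z (u + i v) *)
Definition csol (q : R -> R) (z : R[i]) (u v : R -> R) : Prop :=
  ode_sol q u (fun t => complex.Re z * u t - complex.Im z * v t) /\
  ode_sol q v (fun t => complex.Re z * v t + complex.Im z * u t).

Definition eigenfun (q : R -> R) (lam : R) (u : R -> R) : Prop :=
  rsol q lam u /\ sq_int setT u /\ exists x, u x != 0.

Definition is_eigenvalue (q : R -> R) (lam : R) : Prop :=
  exists u, eigenfun q lam u.

Definition simple_eigenvalue (q : R -> R) (lam : R) : Prop :=
  is_eigenvalue q lam /\
  forall u v, eigenfun q lam u -> eigenfun q lam v ->
    exists c : R, v = (fun t => c * u t).

Definition embedded_eigenvalues (q : R -> R) : set R :=
  [set lam | 0 < lam /\ is_eigenvalue q lam].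

(* the minimal operator (compactly supported elements of the maximal
   domain) is bounded below *)
Definition semibounded_below (q : R -> R) : Prop :=
  exists C : R, forall u f : R -> R,
    (exists a b : R, forall x, x < a \/ b < x -> u x = 0) ->
    sq_int setT f -> ode_sol q u f ->
    C * integ setT (fun t => u t ^+ 2) <= integ setT (fun t => u t * f t).

Definition jost (q : R -> R) (k : R) (u v : R -> R) : Prop :=
  csol q (Complex (k ^+ 2) 0) u v /\
  (u x - cos (k * x) @[x --> +oo] --> 0) /\
  (v x - sin (k * x) @[x --> +oo] --> 0) /\
  (derive1 u x + k * sin (k * x) @[x --> +oo] --> 0) /\
  (derive1 v x - k * cos (k * x) @[x --> +oo] --> 0).

Definition jost_exists_ae (q : R -> R) : Prop :=
  mu.-negligible [set k : R | ~ exists u v, jost q k u v].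

Definition left_weyl (q : R -> R) (z : R[i]) (u v : R -> R) : Prop :=
  csol q z u v /\ sq_int `]-oo, 0] u /\ sq_int `]-oo, 0] v /\
  u 0 = 1 /\ v 0 = 0.

(* u + i v is the boundary value at real k of the (normalized) left Weyl
   solution phi(x, k + i e), e -> 0+ *)
Definition weyl_bv (q : R -> R) (k : R) (u v : R -> R) : Prop :=
  exists U V : R -> R -> R,
    (forall e : R, 0 < e -> left_weyl q ((Complex k e) ^+ 2) (U e) (V e)) /\
    (forall x, ((fun e => U e x) @ (0:R)^'+ --> u x) /\ ((fun e => V e x) @ (0:R)^'+ --> v x)).

Definition cval (u v : R -> R) (x : R) : R[i] := Complex (u x) (v x).
Definition cder (u v : R -> R) (x : R) : R[i] := Complex (derive1 u x) (derive1 v x).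

Definition wronsk (f1 f2 g1 g2 : R -> R) (x : R) : R[i] :=
  cval f1 f2 x * cder g1 g2 x - cder f1 f2 x * cval g1 g2 x.

Definition refl_coef (q : R -> R) (k : R) (r : R[i]) : Prop :=
  exists f1 f2 p1 p2 : R -> R,
    weyl_bv q k f1 f2 /\ jost q k p1 p2 /\
    wronsk f1 f2 p1 p2 0 != 0 /\
    r = - (wronsk f1 f2 p1 (fun t => - p2 t) 0) / wronsk f1 f2 p1 p2 0.

Definition refl_cont_at (q : R -> R) (w : R) : Prop :=
  exists r0 : R[i], forall e : R, 0 < e -> exists d : R, 0 < d /\
    forall (k : R) (r : R[i]), `|k - w| < d -> refl_coef q k r ->
      `|r - r0| < Complex e 0.

Definition jost_pole_cont_at (q : R -> R) (w : R) : Prop :=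
  exists p1 p2 : R -> R, forall (x e : R), 0 < e -> exists d : R, 0 < d /\
    forall (k : R) (u v : R -> R), `|k - w| < d -> jost q k u v ->
      `|(k - w) * u x - p1 x| < e /\ `|(k - w) * v x - p2 x| < e.

Definition orthonormal_set (N : nat) (phi : 'I_N -> R -> R) : Prop :=
  forall n m : 'I_N,
    (\int[mu]_(t in setT) (phi n t * phi m t)%:E)%E = ((n == m)%:R)%:E.

Definition Gminus (N : nat) (phi : 'I_N -> R -> R) (x : R) : 'M[R]_N :=
  \matrix_(n, m) integ `]-oo, x] (fun s => phi n s * phi m s).

Definition q_minusN (q : R -> R) (N : nat) (phi : 'I_N -> R -> R) (x : R) : R :=
  q x - 2 * (derive1 (derive1 (fun y => ln (\det (1%:M - Gminus phi y))))) x.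

End Defs.

(* Main.v *)
Require Import Defs.
From HB Require Import structures.
From mathcomp Require Import all_boot all_order all_algebra.
From mathcomp Require Import all_classical all_reals all_analysis.
From mathcomp Require Import complex.
From mathcomp Require Import perm measurable_realfun ring lra.
Set Implicit Arguments. Unset Strict Implicit. Unset Printing Implicit Defensive.
Import numFieldNormedType.Exports.
Import Order.TTheory GRing.Theory Num.Theory.
Local Open Scope ring_scope.
Local Open Scope classical_set_scope.

(** The potential q_{-N} is a double commutation of q. With phi the vector of
    eigenfunctions, M = I - G_- = int_x^oo phi phi^T and t = M^-1 phi, one has
    (log det M)' = - s with s = phi.t, so q_{-N} = q + 2 s'. A solution u of
    L_q u = l u is carried to u + t.v, where v' = u phi and
    v_n = W(phi_n, u) / (w_n^2 - l), and a solution y for q_{-N} is carried back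
    to y - phi.v, where v' = y t; these maps change the square of the solution
    by the exact derivatives (v.M^-1 v)' and - (v.M v)'. At l = w_n^2 the
    solution carried back is a multiple of phi_n by simplicity, so that
    y = t.d with d constant, and then int^x y^2 = d.M(x)^-1 d + const, which
    blows up as M(x) -> 0.
    The only spectral input is that the Wronskian of two elements of the maximal
    domain vanishes at both infinities (limit point case), which follows from
    semiboundedness. Below, phi, M, t, s are [evec], [Mmx], [tvec], [sfun]. *)

(** * Primitives of locally integrable functions *)

(** Since [q] is only locally integrable, second derivatives exist almost everywhere only. Every
    differential identity is therefore a statement [prim p P], and the product rule [primM] carries
    the calculus. The limit point property comes from the test function [m e^(ix) (f - i h)], with
    [m] a bump of radius [r]; its real and imaginary parts are the two real test functions. The
    factor [e^(ix)] makes the quadratic form see [W(f, h)]. If [W(f, h)] stays above [l] on the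
    support of [m], its contribution is of order [- l r], while all other terms are bounded
    independently of [r]; this contradicts semiboundedness for large [r]. The obstacle is that
    semiboundedness is assumed of [q] and not of q_{-N}, so on the way back the Wronskian of [y] and
    [t_n] cannot be evaluated at infinity. When [l = w_n^2] it is a constant that may differ from 0.
    It is kept as a vector [c], which becomes a source term [c.phi] in the equation for [y - phi.v].
    As that equation is for [q], the limit point property applies to it and gives [c = 0]. *)

Section Primitives.
Variable R : realType.
Local Notation mu := (@lebesgue_measure R).
Implicit Types (a b x : R) (p r P S : R -> R).

(* [P] is locally absolutely continuous and [P' = p] a.e. *)
Definition prim p P : Prop := forall a b, a <= b ->
  mu.-integrable `[a, b] (EFin \o p) /\ P b - P a = integ `[a, b] p.

Lemma integE (A : set R) p : integ A p = \int[mu]_(t in A) p t.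
Proof. by []. Qed.

Lemma itv_chasles p a b c : a <= b -> b <= c ->
  mu.-integrable `[a, c] (EFin \o p) ->
  integ `[a, c] p = integ `[a, b] p + integ `[b, c] p.
Proof.
move=> ab bc pi.
rewrite !integE; have := @Rintegral_itvB R p (BLeft a) (BRight c) b pi.
rewrite !bnd_simp => /(_ ab bc) /eqP; rewrite subr_eq => /eqP ->.
rewrite addrC; congr (_ + _); apply: Rintegral_itv_obnd_cbnd.
by apply: integrableS pi => //; apply: subset_itv; rewrite bnd_simp.
Qed.

Lemma prim_exists p : (forall a b, mu.-integrable `[a, b] (EFin \o p)) ->
  exists P, prim p P.
Proof.
move=> pi; exists (fun x => if 0 <= x then integ `[0, x] p else - integ `[x, 0] p).
move=> a b ab; split=> //.
case: (leP 0 a) => a0.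
  by rewrite (le_trans a0 ab) (itv_chasles a0 ab)// addrC addKr.
case: (leP 0 b) => b0.
  by rewrite (itv_chasles (ltW a0) b0)// opprK addrC.
by rewrite (itv_chasles ab (ltW b0))// opprK addrC addrK.
Qed.

Lemma prim_continuous p P : prim p P -> continuous P.
Proof.
move=> pP x.
have lt1 : x - 1 < x + 1 by lra.
have [pi _] := pP _ _ (ltW lt1).
have := parameterized_integral_continuous (ltW lt1) pi.
move=> /(continuous_within_itvP _ lt1)[+ _ _].
move=> /(_ x); rewrite in_itv/= => /(_ ltac:(lra)) => cx.
have : {for x, continuous (fun y => P (x - 1) + parameterized_integral mu (x - 1) y p)}.
  by apply: cvgD => //; exact: cvg_cst.
rewrite /prop_for /continuous_at.
have E y : x - 1 <= y -> P (x - 1) + parameterized_integral mu (x - 1) y p = P y.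
  by move=> /pP[_]; rewrite /integ /parameterized_integral /Rintegral => <-; rewrite addrC subrK.
rewrite E; last lra.
apply: cvg_trans; apply: near_eq_cvg; near=> y; rewrite E//.
by near: y; exists 1 => //= y; rewrite /= ltr_norml => ?; lra.
Unshelve. all: by end_near. Qed.

Lemma continuous_integrable a b p : continuous p ->
  mu.-integrable `[a, b] (EFin \o p).
Proof.
move=> pc; apply: continuous_compact_integrable; first exact: segment_compact.
exact: continuous_subspaceT.
Qed.

Lemma prim_is_derive p P x : prim p P -> {for x, continuous p} ->
  is_derive x 1 P (p x).
Proof.
move=> pP pc.
have lt1 : x - 1 < x + 1 by lra.
have [pi _] := pP _ _ (ltW lt1).
have xx : x < x + 1 by lra.
have := @continuous_FTC1_closed R p (x - 1) x (x + 1) xx pi ltac:(lra) pc.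
set G := (fun y => _) => -[dG G'].
have := DeriveDef dG erefl; rewrite -derive1E G' => dG0.
have dG' : is_derive x 1 (cst (P (x - 1)) + G) (0 + p x).
  by exact: (@is_deriveD _ _ _ _ _ _ _ _ _ (is_derive_cst _ _ _) dG0).
rewrite -[p x]add0r; apply: near_eq_is_derive dG'.
near=> y; have /pP[_ E] : x - 1 <= y.
  by near: y; exists 1 => //= y; rewrite /= ltr_norml => ?; lra.
by rewrite fctE /G -integE -E addrC subrK.
Unshelve. all: by end_near. Qed.

Lemma prim_ext p r P S : p =1 r -> P =1 S -> prim p P -> prim r S.
Proof. by move=> /funext -> /funext ->. Qed.

Lemma prim_cst (c : R) : prim (fun=> 0) (fun=> c).
Proof.
move=> a b ab; split; first exact: (integrable0 mu).
by rewrite subrr integE Rintegral_cst// mul0r.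
Qed.

Lemma primD p r P S : prim p P -> prim r S ->
  prim (fun x => p x + r x) (fun x => P x + S x).
Proof.
move=> pP rS a b ab; have [pi pE] := pP a b ab; have [ri rE] := rS a b ab.
split; first exact: (@integrableD _ _ _ mu _ _ _ _ pi ri).
by rewrite integE RintegralD// -!integE -pE -rE; ring.
Qed.

Lemma primZ c p P : prim p P -> prim (fun x => c * p x) (fun x => c * P x).
Proof.
move=> pP a b ab; have [pi pE] := pP a b ab.
split; first exact: (@integrableZl _ _ _ mu _ _ c _ pi).
by rewrite integE RintegralZl// -!integE -pE; ring.
Qed.

Lemma primN p P : prim p P -> prim (fun x => - p x) (fun x => - P x).
Proof.
by move=> /(primZ (-1)); apply: prim_ext => x; rewrite mulN1r.
Qed.

Lemma primB p r P S : prim p P -> prim r S ->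
  prim (fun x => p x - r x) (fun x => P x - S x).
Proof. by move=> pP /primN; exact: primD. Qed.

Lemma prim_sum (I : Type) (s : seq I) (p P : I -> R -> R) :
  (forall i, prim (p i) (P i)) ->
  prim (fun x => \sum_(i <- s) p i x) (fun x => \sum_(i <- s) P i x).
Proof.
move=> pP; elim: s => [|i s IH].
  by apply: prim_ext (prim_cst 0) => x; rewrite big_nil.
by apply: prim_ext (primD (pP i) IH) => x; rewrite big_cons.
Qed.

Lemma prim_le p r P S a b : prim p P -> prim r S -> a <= b ->
  (forall t, a <= t <= b -> p t <= r t) -> P b - P a <= S b - S a.
Proof.
move=> pP rS ab pr; have [pi ->] := pP a b ab; have [ri ->] := rS a b ab.
by rewrite !integE; apply: le_Rintegral => // t; rewrite /= in_itv/= => /pr.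
Qed.

Lemma prim_norm_le p r P S a b : prim p P -> prim r S -> a <= b ->
  (forall t, a <= t <= b -> `|p t| <= r t) -> `|P b - P a| <= S b - S a.
Proof.
move=> pP rS ab pr; rewrite ler_norml lerNl.
have pr' t : a <= t <= b -> - r t <= p t <= r t by move=> /pr; rewrite ler_norml.
rewrite (prim_le pP rS)// ?andbT => [|t /pr'/andP[]//].
have := prim_le (primN pP) rS ab; rewrite opprB opprK addrC; apply => t /pr'.
by case/andP => + _; rewrite lerNl.
Qed.

Lemma prim_nondecreasing p P : prim p P -> (forall t, 0 <= p t) ->
  {homo P : x y / x <= y}.
Proof.
move=> pP p0 x y xy; rewrite -subr_ge0.
by have := prim_le (prim_cst 0) pP xy (fun t _ => p0 t); rewrite subrr.
Qed.

Lemma prim0_eq P : prim (fun=> 0) P -> forall x y, P x = P y.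
Proof.
move=> P0; suff H x y : x <= y -> P x = P y.
  by move=> x y; case/orP: (le_total x y) => /H.
move=> xy; have := prim_norm_le P0 (prim_cst 0) xy.
rewrite subr0 => H; apply/esym/eqP; rewrite -subr_eq0 -normr_le0; apply: H => t _.
by rewrite normr0.
Qed.

(** Supremum argument: the points [y] of [[a, b]] with [F a <= F y] contain their supremum, and the
    hypothesis at that supremum pushes past it unless it is [b]. [F] need not be continuous. *)
Lemma local_nondecreasing (F : R -> R) :
  (forall x, exists2 d, 0 < d & forall y z, x - d < y -> y <= x -> x <= z ->
     z < x + d -> F y <= F x /\ F x <= F z) ->
  {homo F : x y / x <= y}.
Proof.
move=> loc a b ab.
pose E := [set y | a <= y <= b /\ F a <= F y].
have Ea : E a by split; rewrite ?lexx ?ab.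
have supE : has_sup E by split; [exists a|exists b => y [/andP[]]].
pose s := sup E.
have as_ : a <= s by apply: sup_ubound => //; case: supE.
have sb : s <= b by apply: sup_le_ub; [exists a|move=> y [/andP[]]].
have [d d0 ds] := loc s.
have [y [/andP[ay yb] Fy] sy] := sup_adherent d0 supE.
have ys : y <= s by apply: sup_ubound; [case: supE|split=> //; rewrite ay].
have sd : s < s + d by lra.
have Fs : F a <= F s by apply: (le_trans Fy); have [] := ds _ _ sy ys (lexx s) sd.
have [sltb|bs] := ltP s b; last by have -> : b = s by apply/eqP; rewrite eq_le bs sb.
pose z := Num.min (s + d / 2) b.
have sz : s < z by rewrite lt_min sltb andbT; lra.
have zd : z < s + d by rewrite gt_min; apply/orP; left; lra.
have [_ Fz] := ds _ _ sy ys (ltW sz) zd.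
have : E z.
  split; last exact: le_trans Fz.
  by rewrite (le_trans as_ (ltW sz))/= ge_min lexx orbT.
move=> /(sup_ubound (proj2 supE)); rewrite -/s => zs.
by move: (lt_le_trans sz zs); rewrite ltxx.
Qed.

Lemma integrable_continuousM p P a b : mu.-integrable `[a, b] (EFin \o p) ->
  continuous P -> mu.-integrable `[a, b] (EFin \o (fun x => p x * P x)).
Proof.
move=> pi Pc; apply: (@integrableMl _ _ _ mu _ _ _ P pi) => //.
  by apply: measurable_funTS; apply: continuous_measurable_fun.
have /compact_bounded[M [_ mrt]] := continuous_compact
  (continuous_subspaceT (A := `[a, b]) Pc) (segment_compact (a := a) (b := b)).
by exists M; split; rewrite ?num_real // => ? ? ? ?; apply: mrt => //; eexists.
Qed.

(** Let [D] be [P S] minus a primitive [T] of [p S + P r], and [V] a primitive of [|p| + |r|]. Where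
    [P] and [S] oscillate by at most [e], an increment of [D] is at most [e] times that of [V]. So
    [e V + D] and [e V - D] are locally, hence globally, nondecreasing, and letting [e] tend to 0
    makes [D] constant. No differentiation almost everywhere is involved. *)
Lemma primM p r P S : prim p P -> prim r S ->
  prim (fun x => p x * S x + P x * r x) (fun x => P x * S x).
Proof.
move=> pP rS.
have Pc := prim_continuous pP; have Sc := prim_continuous rS.
have ti a b : mu.-integrable `[a, b] (EFin \o (fun x => p x * S x + P x * r x)).
  have [ab|ba] := leP a b; last first.
    rewrite set_itv_ge -?leNgt ?bnd_simp ?ltW//; exact: integrable_set0.
  have [pi _] := pP a b ab; have [ri _] := rS a b ab.
  have := integrable_continuousM ri Pc.
  rewrite (_ : (fun x => r x * P x) = (fun x => P x * r x)); last first.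
    by apply/funext => x; rewrite mulrC.
  by move=> /(@integrableD _ _ _ mu _ _ _ _ (integrable_continuousM pi Sc)); apply.
have vi a b : mu.-integrable `[a, b] (EFin \o (fun x => `|p x| + `|r x|)).
  have [ab|ba] := leP a b; last first.
    rewrite set_itv_ge -?leNgt ?bnd_simp ?ltW//; exact: integrable_set0.
  have [pi _] := pP a b ab; have [ri _] := rS a b ab.
  exact: (@integrableD _ _ _ mu _ _ _ _ (integrable_norm pi) (integrable_norm ri)).
have [T tT] := prim_exists ti; have [V vV] := prim_exists vi.
pose D x := P x * S x - T x.
have small a b (e : R) : a <= b -> (forall t, a <= t <= b -> `|S b - S t| <= e) ->
    (forall t, a <= t <= b -> `|P a - P t| <= e) ->
    `|D b - D a| <= e * V b - e * V a.
  move=> ab Se Pe.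
  (* With [S b] and [P a] frozen, [S b * P + P a * S] has on [[a, b]] exactly the same increment as
     [P S], and its density differs from [p S + P r] by terms with the small factors [S b - S t] and
     [P a - P t]. *)
  have := primB (primD (primZ (S b) pP) (primZ (P a) rS)) tT.
  move=> /prim_norm_le/(_ (primZ e vV) ab).
  have -> : D b - D a = S b * P b + P a * S b - T b - (S b * P a + P a * S a - T a).
    by rewrite /D; ring.
  apply=> t abt.
  have -> : S b * p t + P a * r t - (p t * S t + P t * r t) =
    (S b - S t) * p t + (P a - P t) * r t by ring.
  rewrite (le_trans (ler_normD _ _))// !normrM mulrDr lerD// ler_wpM2r//.
    exact: Se.
  exact: Pe.
have mono (e : R) : 0 < e -> forall s : bool,
    {homo (fun x => e * V x + (-1) ^+ s * D x) : x y / x <= y}.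
  move=> e0 s; apply: local_nondecreasing => x.
  have e20 : 0 < e / 2 by lra.
  move/cvgrPdist_lt: (Pc x) => /(_ _ e20)[d1 /= d10 Pd].
  move/cvgrPdist_lt: (Sc x) => /(_ _ e20)[d2 /= d20 Sd].
  pose d := Num.min d1 d2.
  have d0 : 0 < d by rewrite lt_min d10.
  have osc t u : x - d < t -> t < x + d -> x - d < u -> u < x + d ->
      `|P t - P u| <= e /\ `|S t - S u| <= e.
    have near1 v : x - d < v -> v < x + d -> `|x - v| < d1 /\ `|x - v| < d2.
      move=> xv vx; split; rewrite ltr_norml; have := ge_min d1 d1 d2;
        have := ge_min d2 d1 d2; rewrite !lexx orbT/= -/d => H1 H2; lra.
    move=> /near1 H1 /H1[/Pd{}+ /Sd{}+] /near1 H2 /H2[/Pd{}+ /Sd{}+].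
    by rewrite !ltr_norml => *; split; rewrite ler_norml; lra.
  have step y z : x - d < y -> y <= z -> z < x + d ->
      e * V y + (-1) ^+ s * D y <= e * V z + (-1) ^+ s * D z.
    move=> xy yz zx.
    have : `|D z - D y| <= e * V z - e * V y.
      apply: small => // t /andP[yt tz]; apply osc; lra.
    by rewrite ler_norml; case: s => /=; rewrite ?expr0 ?expr1; lra.
  by exists d => // y z xy yx xz zx; split; apply: step; lra.
have D0 a b : a <= b -> D b = D a.
  move=> ab; apply/eqP; rewrite -subr_eq0 -normr_le0.
  apply/ler_addgt0Pl => e e0; rewrite addr0.
  have V0 : 0 <= V b - V a.
    by rewrite subr_ge0 (prim_nondecreasing vV)// => t; rewrite addr_ge0.
  (* The added 1 keeps the denominator positive when [V b = V a]. *)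
  pose e' := e / (V b - V a + 1).
  have e'0 : 0 < e' by rewrite divr_gt0//; lra.
  have := mono _ e'0 false _ _ ab; have := mono _ e'0 true _ _ ab.
  rewrite /= expr0 expr1 => H1 H2.
  have : e' * (V b - V a) <= e.
    rewrite /e' mulrAC ler_pdivrMr; last lra.
    by rewrite ler_wpM2l ?ltW//; lra.
  rewrite mulrBr => H3; rewrite ler_norml; lra.
move=> a b ab; split=> //; have [_ <-] := tT a b ab.
by have := D0 a b ab; rewrite /D; lra.
Qed.

Lemma is_derive_prim p P : (forall x, is_derive x 1 P (p x)) -> continuous p ->
  prim p P.
Proof.
move=> dP pc.
have [S pS] := prim_exists (fun a b => continuous_integrable a b pc).
have dd x : is_derive x 1 (P - S) 0.
  rewrite -(subrr (p x)); have := prim_is_derive pS (pc x) => dS.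
  exact: (@is_deriveB _ _ _ _ _ _ _ _ _ (dP x) dS).
have E : forall x, P x = (P 0 - S 0) + S x.
  move=> x; have E : P x - S x = P 0 - S 0 := @is_derive_0_is_cst R (P - S) x 0 dd.
  by rewrite -E subrK.
apply: prim_ext (primD (prim_cst (P 0 - S 0)) pS) => x; first by rewrite add0r.
by rewrite -E.
Qed.

Lemma continuous_support_integral p a b : a <= b -> continuous p ->
  (forall x, x < a \/ b < x -> p x = 0) ->
  mu.-integrable setT (EFin \o p) /\ integ setT p = integ `[a, b] p.
Proof.
move=> ab pc p0.
have pE : p = p \_ `[a, b].
  apply/funext => x; rewrite patchE; case: ifPn => // /negP; rewrite inE/= in_itv/=.
  by move=> /negP; rewrite negb_and -!ltNge => /orP/p0.
split; last by rewrite {1}pE !integE -Rintegral_mkcond.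
rewrite pE -restrict_EFin.
by apply/(integrable_mkcond _ _).1 => //; exact: continuous_integrable.
Qed.

Lemma prim_integral p : mu.-integrable setT (EFin \o p) ->
  prim p (fun x => integ `]-oo, x] p).
Proof.
move=> pi a b ab; split; first by apply: integrableS pi.
have pb : mu.-integrable `]-oo, b] (EFin \o p) by apply: integrableS pi.
rewrite !integE (Rintegral_itvB pb)//.
by apply: Rintegral_itv_obnd_cbnd; apply: integrableS pi.
Qed.

(** Dominated convergence with majorant [|p|], stated for both ends at once: [A] is the whole line
    when [u] tends to +oo and empty when it tends to -oo. *)
Lemma cvg_integral_itv p (u : R^nat) (A : set R) :
  mu.-integrable setT (EFin \o p) -> measurable A ->
  (forall x, \forall n \near \oo, (x <= u n) = (x \in A)) ->
  integ `]-oo, u n] p @[n --> \oo] --> integ A p.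
Proof.
move=> pi mA ux.
have := @dominated_convergence _ _ R mu setT measurableT
  (fun n => EFin \o (p \_ `]-oo, u n])) (EFin \o (p \_ A)) (EFin \o (Num.norm \o p)).
have mp : measurable_fun setT p by move/integrableP: pi => -[/measurable_EFinP].
case.
- move=> n; apply/measurable_EFinP; apply/(measurable_restrictT _ _).1 => //.
  exact: measurable_funTS.
- apply/measurable_EFinP; apply/(measurable_restrictT _ _).1 => //.
  exact: measurable_funTS.
- apply: aeW => x _ /=; apply/cvg_EFin; first by near=> n.
  apply: cvg_near_cst; have := ux x; apply: filterS => n E.
  by rewrite /= !patchE -E; congr (if _ then _ else _); rewrite mem_setE in_itv.
- exact: integrable_norm.
- apply: aeW => x n _ /=; rewrite lee_fin patchE; case: ifP => // _.
  by rewrite normr0.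
move=> _ _ H; rewrite integE Rintegral_mkcond.
rewrite [X in X @ _](_ : _ = fun n => \int[mu]_x (p \_ `]-oo, u n]) x); last first.
  by apply/funext => n; rewrite integE Rintegral_mkcond.
apply: fine_cvg; rewrite fineK//.
apply: integrable_fin_num => //.
have -> : (fun x => ((p \_ A) x)%:E) = (EFin \o p) \_ A by rewrite restrict_EFin.
by apply/(integrable_mkcond _ _).1 => //; apply: integrableS pi.
Unshelve. all: by end_near. Qed.

Lemma cvgy_integral p : mu.-integrable setT (EFin \o p) ->
  integ `]-oo, x] p @[x --> +oo] --> integ setT p.
Proof.
move=> pi; apply/cvg_pinftyP => u uoo; apply: cvg_integral_itv => // x.
by move/cvgryPge: uoo => /(_ x); apply: filterS => n ->; rewrite in_setT.
Qed.

Lemma cvgNy_integral p : mu.-integrable setT (EFin \o p) ->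
  integ `]-oo, x] p @[x --> -oo] --> (0 : R).
Proof.
move=> pi; apply/cvg_ninftyP => u uoo.
rewrite -(Rintegral_set0 mu p); apply: cvg_integral_itv => // x.
move/cvgrNyPlt: uoo => /(_ x); apply: filterS => n ux.
by rewrite leNgt ux in_set0.
Qed.

Lemma sq_int_prim (u : R -> R) : continuous u -> sq_int setT u ->
  exists U, prim (fun t => u t ^+ 2) U /\ exists K, forall x, 0 <= U x <= K.
Proof.
move=> uc ui; exists (fun x => integ `]-oo, x] (fun t => u t ^+ 2)); split.
  exact: prim_integral.
exists (integ setT (fun t => u t ^+ 2)) => x.
rewrite !integE Rintegral_ge0/=; last by move=> *; exact: sqr_ge0.
rewrite Rintegral_mkcond; apply: le_Rintegral => //.
  by rewrite -restrict_EFin; apply/(integrable_mkcond _ _).1 => //; apply: integrableS ui.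
by move=> t _; rewrite patchE; case: ifP => // _; exact: sqr_ge0.
Qed.

(** Monotone convergence along [[-n, n]]. Both transforms get their square integrability here, from
    a bound on the increments of an explicit primitive. *)
Lemma prim_sq_int (u U : R -> R) (K : R) : continuous u -> prim (fun t => u t ^+ 2) U ->
  (forall a b, a <= b -> U b - U a <= K) -> sq_int setT u.
Proof.
move=> uc uU UK.
have u2c : continuous (fun t => u t ^+ 2).
  by move=> x; apply: cvgM; exact: uc.
have mu2 : measurable_fun setT (fun t => u t ^+ 2) by exact: continuous_measurable_fun.
apply/integrableP; split; first exact/measurable_EFinP.
have U0 : (\bigcup_n `[- n%:R, n%:R]%classic = [set: R]).
  rewrite -subTset => x _; exists (Num.truncn `|x|).+1 => //=.
  by rewrite in_itv/= -ler_norml ltW// truncnS_gt.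
have nd : nondecreasing_seq (fun n => `[- n%:R, n%:R]%classic : set R).
  move=> n m nm; apply/subsetPset; apply: subset_itv; rewrite bnd_simp ?lerN2 ler_nat//.
have Icvg := @ge0_nondecreasing_set_cvg_integral _ (measurableTypeR R) R
  (fun n => `[- n%:R, n%:R]%classic : set R) (fun t => (`|u t ^+ 2|)%:E) mu nd.
have {}Icvg := Icvg ltac:(by move=> i) ltac:(move=> i; apply/measurable_EFinP;
  apply: measurable_funTS; exact: measurableT_comp) ltac:(by move=> *; rewrite lee_fin).
rewrite U0 in Icvg.
apply: (@le_lt_trans _ _ K%:E); last exact: ltry.
move/cvg_lim: Icvg => <- //; apply: lime_le.
  apply: ereal_nondecreasing_is_cvgn => n m nm.
  apply: ge0_subset_integral => //=; [|by move/subsetPset: (nd _ _ nm)].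
  by apply/measurable_EFinP; apply: measurable_funTS; exact: measurableT_comp.
apply: nearW => n; have nn : - n%:R <= n%:R :> R.
  by rewrite (@le_trans _ _ 0)// oppr_le0.
have [ui uE] := uU _ _ nn.
have -> : (fun x => (`|u x ^+ 2|)%:E) = (EFin \o (fun t => u t ^+ 2)).
  by apply/funext => t; rewrite ger0_norm ?sqr_ge0.
apply: (@le_trans _ _ (integ `[- n%:R, n%:R] (fun t => u t ^+ 2))%:E).
  by rewrite /integ fineK//; exact: integrable_fin_num.
by rewrite lee_fin -uE; exact: UK.
Qed.

End Primitives.

(** * Continuity of pointwise operations *)

Section Continuity.
Variable R : realType.
Implicit Types f g : R -> R.

Lemma cont_cst (c : R) : continuous (fun _ : R => c).
Proof. by move=> x; exact: cvg_cst. Qed.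

Lemma cont_id : continuous (fun x : R => x).
Proof. by move=> x; exact: cvg_id. Qed.

Lemma contD f g : continuous f -> continuous g -> continuous (fun x => f x + g x).
Proof. by move=> fc gc x; apply: cvgD; [exact: fc|exact: gc]. Qed.

Lemma contN f : continuous f -> continuous (fun x => - f x).
Proof. by move=> fc x; apply: cvgN; exact: fc. Qed.

Lemma contM f g : continuous f -> continuous g -> continuous (fun x => f x * g x).
Proof. by move=> fc gc x; apply: cvgM; [exact: fc|exact: gc]. Qed.

Lemma cont_normr f : continuous f -> continuous (fun x => `|f x|).
Proof. by move=> fc x; apply: cvg_norm; exact: fc. Qed.

Lemma contX n f : continuous f -> continuous (fun x => f x ^+ n).
Proof.
move=> fc; elim: n => [|n IH].
  by rewrite (_ : (fun x => _) = fun=> 1); [exact: cont_cst|apply/funext => x; rewrite expr0].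
rewrite (_ : (fun x => _) = fun x => f x * f x ^+ n); first exact: contM.
by apply/funext => x; rewrite exprS.
Qed.

Lemma cont_sum (I : Type) (s : seq I) (F : I -> R -> R) :
  (forall i, continuous (F i)) -> continuous (fun x => \sum_(i <- s) F i x).
Proof.
move=> Fc; elim: s => [|i s IH].
  by rewrite (_ : (fun x => _) = fun=> 0); [exact: cont_cst|apply/funext => x; rewrite big_nil].
rewrite (_ : (fun x => _) = fun x => F i x + \sum_(i <- s) F i x); first exact: contD.
by apply/funext => x; rewrite big_cons.
Qed.

End Continuity.

Ltac cont := cbv beta; lazymatch goal with
  | |- continuous (fun x => x) => exact: cont_id
  | H : continuous ?f |- continuous ?f => exact H
  | H : continuous ?f |- continuous (fun x => ?f x) => exact H
  | |- continuous (fun x => @?f x + @?g x) => apply: (@contD _ f g); cont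
  | |- continuous (fun x => - @?f x) => apply: (@contN _ f); cont
  | |- continuous (fun x => @?f x * @?g x) => apply: (@contM _ f g); cont
  | |- continuous (fun x => @?f x ^+ ?n) => apply: (@contX _ n f); cont
  | |- continuous (fun x => `|@?f x|) => apply: (@cont_normr _ f); cont
  | |- continuous (fun x => ?c) => exact: cont_cst
  | |- _ => idtac
  end.

(** * The limit point property *)

Section LimitPoint.
Variable R : realType.
Local Notation mu := (@lebesgue_measure R).
Implicit Types (q f h F H u v : R -> R).

(** An exponent of at least 2 makes the truncated power differentiable at 0 as well: there the
    difference quotient is [max 0 h ^+ n.+1] for either sign of [h]. *)
Lemma is_derive_max0X n (x : R) :
  is_derive x 1 (fun y : R => Num.max 0 y ^+ n.+2) (n.+2%:R * Num.max 0 x ^+ n.+1).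
Proof.
have [x0|x0|->] := ltgtP x 0.
- rewrite expr0n/= mulr0.
  apply: (near_eq_is_derive (f := cst 0)) (is_derive_cst _ _ _).
  near=> y; have y0 : y < 0 by near: y; exact: lt_nbhsl.
  by rewrite (max_idPl (ltW y0)) expr0n.
- have d : is_derive x 1 (fun y : R => y ^+ n.+2) (n.+2%:R * x ^+ n.+1).
    have := is_deriveX n.+2 (is_derive_id x (1 : R)).
    by rewrite exprfctE /GRing.scale/= mulr1.
  apply: near_eq_is_derive d.
  near=> y; have y0 : 0 < y by near: y; exact: lt_nbhsr.
  by rewrite (max_idPr (ltW y0)).
- rewrite expr0n/= mulr0.
  have cm : continuous (fun y : R => Num.max 0 y ^+ n.+1).
    apply: contX; rewrite (_ : Num.max 0 = (fun y : R => (0 + y + `|0 - y|) / 2)); first by cont.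
    by apply/funext => y; rewrite maxr_absE.
  have H : h^-1 *: (Num.max 0 (h *: (1 : R) + 0) ^+ n.+2 - Num.max 0 0 ^+ n.+2)
      @[h --> 0^'] --> (0 : R).
    have : Num.max 0 h ^+ n.+1 @[h --> (0:R)^'] --> (0 : R).
      move: (cm 0); rewrite /continuous_at maxxx expr0n/=.
      exact: cvg_within_filter.
    apply: cvg_trans; apply: near_eq_cvg; near=> y.
    have y0 : y != 0 by near: y; exact: nbhs_dnbhs_neq.
    rewrite addr0 maxxx expr0n/= subr0 scaler1 [in RHS]exprS.
    have [yl|yl|yl] := ltgtP y 0; last by rewrite yl eqxx in y0.
      by rewrite mul0r scaler0 expr0n.
    by rewrite /GRing.scale/= mulKf.
  by apply: DeriveDef; [apply/cvg_ex; exists 0|apply/cvg_lim].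
Unshelve. all: by end_near. Qed.

(** The bump is the cube of the positive part of [1 - ((x - c) / r)^2]; the cube makes it twice
    continuously differentiable. As [r >= 1], the bound 6 on the derivative does not depend on [r].
    On the middle half the base is at least 3/4, and [(3/4)^3 > 1/4]. *)
Lemma bump_exists (c r : R) : 1 <= r -> exists m m1 m2 : R -> R,
  [/\ prim m1 m, prim m2 m1 & continuous m2] /\
  [/\ forall x : R, 0 <= m x <= 1 /\ `|m1 x| <= 6,
      forall x : R, x <= c - r \/ c + r <= x -> [/\ m x = 0, m1 x = 0 & m2 x = 0] &
      forall x : R, c - r / 2 <= x <= c + r / 2 -> 1 / 4 <= m x].
Proof.
move=> r1; have r0 : 0 < r by lra.
pose g (x : R) : R := 1 - ((x - c) / r) ^+ 2.
pose g1 (x : R) : R := - (2 * (x - c) / r ^+ 2).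
pose p (x : R) : R := Num.max 0 (g x).
have dg (x : R) : is_derive x 1 g (g1 x).
  rewrite /g; apply: is_derive_eq.
  by rewrite /GRing.scale/= /g1; field; rewrite gt_eqF.
have dg1 (x : R) : is_derive x 1 g1 (- (2 / r ^+ 2)).
  rewrite /g1; apply: is_derive_eq.
  by rewrite /GRing.scale/=; field; rewrite gt_eqF.
have gc : continuous g.
  by move=> x; apply: differentiable_continuous; apply/derivable1_diffP; apply: ex_derive.
have g1c : continuous g1.
  by move=> x; apply: differentiable_continuous; apply/derivable1_diffP; apply: ex_derive.
have pc : continuous p.
  rewrite (_ : p = fun x => (0 + g x + `|0 - g x|) / 2); first by cont.
  by apply/funext => x; rewrite /p maxr_absE.
have dp n (x : R) : is_derive x 1 (fun y => p y ^+ n.+2) (n.+2%:R * p x ^+ n.+1 * g1 x).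
  exact: (@is_derive1_comp R (fun y => Num.max 0 y ^+ n.+2) g x _ _ (is_derive_max0X n (g x)) (dg x)).
pose m (x : R) : R := p x ^+ 3.
pose m1 (x : R) : R := 3 * p x ^+ 2 * g1 x.
pose m2 (x : R) : R := 3 * (2 * p x * g1 x) * g1 x + 3 * p x ^+ 2 * (- (2 / r ^+ 2)).
have m1c : continuous m1 by rewrite /m1; cont.
have m2c : continuous m2 by rewrite /m2; cont.
exists m, m1, m2; split.
  split=> //; first by apply: is_derive_prim => // x; exact: (is_derive_eq (dp 1%N x)).
  apply: is_derive_prim => // x; have d2 := dp 0%N x.
  have d3 := is_deriveM (is_deriveM (is_derive_cst (3 : R) x 1) d2) (dg1 x).
  apply: (is_derive_eq d3).
  by rewrite /GRing.scale/= !fctE /m2 expr1; ring.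
have p01 (x : R) : 0 <= p x <= 1.
  rewrite le_max lexx/= ge_max ler01/= /g lerBlDr lerDl; exact: sqr_ge0.
split.
- move=> x; have /andP[p0 p1] := p01 x; split.
    by rewrite exprn_ge0//= exprn_ile1.
  have [g0|g0] := leP (g x) 0.
    by rewrite /m1 /p (max_idPl g0) expr0n/= mulr0 mul0r normr0.
  have y1 : `|(x - c) / r| <= 1.
    by rewrite -(@expr_le1 _ 2)// real_normK ?num_real//; move: g0; rewrite /g; lra.
  have -> : m1 x = - (6 * (p x ^+ 2 * ((x - c) / r)) / r).
    by rewrite /m1 /g1; field; rewrite gt_eqF.
  rewrite normrN normrM normfV (gtr0_norm r0) ler_pdivrMr//.
  rewrite normrM (ger0_norm (_ : 0 <= 6))// ler_pM// normrM.
  by rewrite (le_trans _ r1)// mulr_ile1// ger0_norm ?exprn_ge0// exprn_ile1.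
- move=> x xr; have g0 : g x <= 0.
    have : 1 <= `|(x - c) / r|.
      rewrite normrM normfV (gtr0_norm r0) ler_pdivlMr// mul1r.
      by case: xr => ?; rewrite ler_normr; apply/orP; [right|left]; lra.
    by rewrite -(@expr_ge1 _ 2)// real_normK ?num_real// /g; lra.
  by rewrite /m /m1 /m2 /p (max_idPl g0) !expr0n/=; split; ring.
- move=> x /andP[x1 x2].
  have g34 : 3 / 4 <= g x.
    have : `|(x - c) / r| <= 1 / 2.
      rewrite normrM normfV (gtr0_norm r0) ler_pdivrMr// ler_norml; lra.
    by rewrite /g ler_norml; move: ((x - c) / r) => y /andP[y1 y2]; nra.
  have p34 : 3 / 4 <= p x by rewrite le_max g34 orbT.
  rewrite /m; have : (3 / 4 : R) ^+ 3 <= p x ^+ 3 by apply: lerXn2r => //; rewrite nnegrE; lra.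
  by lra.
Qed.

Definition wronskian f h (x : R) : R := f x * derive1 h x - derive1 f x * h x.

(** With [ode_sol_prim] this translates between the equation and a pair of [prim] statements; new
    solutions are always built through it. *)
Lemma ode_sol_intro q u f (v : R -> R) : prim v u ->
  prim (fun t => q t * u t - f t) v -> ode_sol q u f /\ derive1 u = v.
Proof.
move=> uv qv; have vc := prim_continuous qv.
have du x := prim_is_derive uv (vc x).
have uvE : derive1 u = v.
  by apply/funext => x; rewrite derive1E; exact: (@derive_val _ _ _ _ _ _ _ (du x)).
split=> //; split; first by move=> x; exact: ex_derive.
by rewrite uvE.
Qed.

Lemma ode_sol_prim q u f : ode_sol q u f ->
  [/\ prim (derive1 u) u, prim (fun t => q t * u t - f t) (derive1 u),
      continuous u & continuous (derive1 u)].
Proof.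
move=> [du qu]; have dc := prim_continuous qu.
have du' : prim (derive1 u) u.
  by apply: is_derive_prim => // x; apply: DeriveDef => //; rewrite derive1E.
by split=> //; exact: prim_continuous du'.
Qed.

Lemma ode_solD q u f v h : ode_sol q u f -> ode_sol q v h ->
  ode_sol q (fun t => u t + v t) (fun t => f t + h t).
Proof.
move=> /ode_sol_prim[u1 u2 _ _] /ode_sol_prim[v1 v2 _ _].
apply: (proj1 (ode_sol_intro (primD u1 v1) _)).
by apply: prim_ext (primD u2 v2) => // t; ring.
Qed.

Lemma ode_solM q u f (a a1 a2 : R -> R) : ode_sol q u f -> prim a1 a -> prim a2 a1 ->
  ode_sol q (fun t => a t * u t)
    (fun t => a t * f t - 2 * a1 t * derive1 u t - a2 t * u t).
Proof.
move=> /ode_sol_prim[u1 u2 _ _] aa1 aa2.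
apply: (proj1 (ode_sol_intro (primM aa1 u1) _)).
by apply: prim_ext (primD (primM aa2 u1) (primM aa1 u2)) => // t; ring.
Qed.

Lemma prim_wronskian q f F h H : ode_sol q f F -> ode_sol q h H ->
  prim (fun t => F t * h t - f t * H t) (wronskian f h).
Proof.
move=> /ode_sol_prim[f1 f2 _ _] /ode_sol_prim[h1 h2 _ _].
by apply: prim_ext (primB (primM f1 h2) (primM f2 h1)) => // t; ring.
Qed.

Lemma wronskianC f h x : wronskian h f x = - wronskian f h x.
Proof. by rewrite /wronskian; ring. Qed.

Lemma prim_id : prim (fun=> 1) (fun x : R => x).
Proof. by apply: is_derive_prim; exact: cont_cst. Qed.

Lemma prim_cos : prim (fun x : R => - sin x) cos.
Proof.
apply: (is_derive_prim (fun x => is_derive_cos x)); apply: contN; exact: continuous_sin.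
Qed.

Lemma prim_sin : prim (cos : R -> R) sin.
Proof. exact: (is_derive_prim (fun x => is_derive_sin x) (@continuous_cos R)). Qed.

(* Test the form on [m cos f + m sin h] and [m sin f - m cos h]: adding the two
   inequalities, the mixed terms [f H + h F] cancel and only
   [- 2 m^2 W(f, h)] remains, while all other terms stay integrable. *)
Lemma wronskian_bound q f F h H : semibounded_below q ->
  ode_sol q f F -> ode_sol q h H -> continuous F -> continuous H ->
  sq_int setT f -> sq_int setT F -> sq_int setT h -> sq_int setT H ->
  exists K : R, forall c r l : R, 1 <= r -> 0 < l ->
    (forall x, c - r <= x <= c + r -> l <= wronskian f h x) -> l * r <= K.
Proof.
move=> [C sb] sf sh Fc Hc fi Fi hi Hi.
have [f1 f2 fc f'c] := ode_sol_prim sf; have [h1 h2 hc h'c] := ode_sol_prim sh.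
have [Uf [pf [Kf bf]]] := sq_int_prim fc fi.
have [UF [pF [KF bF]]] := sq_int_prim Fc Fi.
have [Uh [ph [Kh bh]]] := sq_int_prim hc hi.
have [UH [pH [KH bH]]] := sq_int_prim Hc Hi.
(* In the bound of [z + X1] below, [f^2] gets [1 + |C|] from [f (F - C f)] and [37 = 6^2 + 1] from
   [m1^2 + m^2]; likewise for [h^2]. *)
pose k : R := 38 + `|C|.
pose e t := k * (f t ^+ 2 + F t ^+ 2 + h t ^+ 2 + H t ^+ 2).
pose E t := k * (Uf t + UF t + Uh t + UH t).
have eE : prim e E by exact: primZ (primD (primD (primD pf pF) ph) pH).
have k0 : 0 <= k by rewrite addr_ge0.
pose KE := k * (Kf + KF + Kh + KH).
have EK a b : E b - E a <= KE.
  have := bf a; have := bf b; have := bF a; have := bF b.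
  have := bh a; have := bh b; have := bH a; have := bH b.
  move=> *; rewrite /E /KE -mulrBr ler_wpM2l//; lra.
(* On the middle half, of length [r], [m >= 1/4] gives [2 m^2 W >= l / 8]; hence [l r / 8 <= KE]. *)
exists (8 * KE) => c r l r1 l0 Wl.
have [m [m1 [m2 [[pm pm1 m2c] [mb m0 mq]]]]] := bump_exists c r1.
have mc := prim_continuous pm; have m1c := prim_continuous pm1.
have cc : continuous (cos : R -> R) by exact: continuous_cos.
have sc : continuous (sin : R -> R) by exact: continuous_sin.
pose a t := m t * cos t; pose b t := m t * sin t.
pose a1 t := m1 t * cos t + m t * - sin t; pose b1 t := m1 t * sin t + m t * cos t.
pose a2 t := (m2 t * cos t + m1 t * - sin t) + (m1 t * - sin t + m t * - cos t).
pose b2 t := (m2 t * sin t + m1 t * cos t) + (m1 t * cos t + m t * - sin t).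
have pa : prim a1 a := primM pm prim_cos.
have pb : prim b1 b := primM pm prim_sin.
have pa1 : prim a2 a1 := primD (primM pm1 prim_cos) (primM pm (primN prim_sin)).
have pb1 : prim b2 b1 := primD (primM pm1 prim_sin) (primM pm prim_cos).
pose u1 t := a t * f t + b t * h t.
pose u2 t := b t * f t + - a t * h t.
pose g1 t := (a t * F t - 2 * a1 t * derive1 f t - a2 t * f t) +
             (b t * H t - 2 * b1 t * derive1 h t - b2 t * h t).
pose g2 t := (b t * F t - 2 * b1 t * derive1 f t - b2 t * f t) +
             (- a t * H t - 2 * - a1 t * derive1 h t - - a2 t * h t).
have s1 : ode_sol q u1 g1 := ode_solD (ode_solM sf pa pa1) (ode_solM sh pb pb1).
have s2 : ode_sol q u2 g2 :=
  ode_solD (ode_solM sf pb pb1) (ode_solM sh (primN pa) (primN pa1)).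
have ab : c - r <= c + r by lra.
have out x : x < c - r \/ c + r < x -> [/\ u1 x = 0, u2 x = 0, g1 x = 0 & g2 x = 0].
  move=> xr; have [|m0x m10 m20] := m0 x; first by case: xr => /ltW; [left|right].
  by rewrite /u1 /u2 /g1 /g2 /a /b /a1 /b1 /a2 /b2 m0x m10 m20; split; ring.
have ac : continuous a by rewrite /a; cont.
have bc : continuous b by rewrite /b; cont.
have a1c : continuous a1 by rewrite /a1; cont.
have b1c : continuous b1 by rewrite /b1; cont.
have a2c : continuous a2 by rewrite /a2; cont.
have b2c : continuous b2 by rewrite /b2; cont.
have u1c : continuous u1 by rewrite /u1; cont.
have u2c : continuous u2 by rewrite /u2; cont.
have g1c : continuous g1 by rewrite /g1; cont.
have g2c : continuous g2 by rewrite /g2; cont.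
have form u g : ode_sol q u g -> continuous u -> continuous g ->
    (forall x, x < c - r \/ c + r < x -> u x = 0 /\ g x = 0) ->
    0 <= integ `[c - r, c + r] (fun t => u t * (g t - C * u t)).
  move=> su uc gc u0.
  have gi : sq_int setT g.
    apply: (proj1 (continuous_support_integral ab _ _)); first by cont.
    by move=> x /u0[_ ->]; rewrite expr0n.
  have supp : exists a b : R, forall x, x < a \/ b < x -> u x = 0.
    by exists (c - r), (c + r) => x /u0[].
  have := sb u g supp gi su.
  have u2i := continuous_support_integral ab (contX (n := 2) uc) (fun x xr =>
    ltac:(by rewrite (proj1 (u0 x xr)) expr0n) : u x ^+ 2 = 0).
  have ugi := continuous_support_integral ab (contM uc gc) (fun x xr =>
    ltac:(by rewrite (proj1 (u0 x xr)) mul0r) : u x * g x = 0).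
  rewrite (proj2 u2i) (proj2 ugi) -subr_ge0 => /le_trans; apply.
  rewrite !integE -RintegralZl//; last by apply: continuous_integrable; cont.
  rewrite -RintegralB//; [|by apply: continuous_integrable; cont..].
  by rewrite le_eqVlt; apply/orP; left; apply/eqP; apply: eq_Rintegral => x _; ring.
have F1 := form _ _ s1 u1c g1c ltac:(by move=> x /out[]).
have F2 := form _ _ s2 u2c g2c ltac:(by move=> x /out[]).
pose z t := u1 t * (g1 t - C * u1 t) + u2 t * (g2 t - C * u2 t).
have zc : continuous z by rewrite /z; cont.
have [Z zZ] := prim_exists (fun a b => continuous_integrable a b zc).
have Z0 : 0 <= Z (c + r) - Z (c - r).
  have [_ ->] := zZ _ _ ab.
  rewrite integE RintegralD//; [by rewrite addr_ge0| |];
    by apply: continuous_integrable; cont.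
(* An integration by parts: adding [X1] to [z] removes the terms in [m2] and the products [f f'] and
   [h h'], so that [f'] and [h'] survive only in the Wronskian. [X] vanishes at both ends of the
   support. *)
pose X t := m t * m1 t * (f t * f t + h t * h t).
pose X1 t := (m1 t * m1 t + m t * m2 t) * (f t * f t + h t * h t) +
  m t * m1 t * ((derive1 f t * f t + f t * derive1 f t) +
                (derive1 h t * h t + h t * derive1 h t)).
have pX : prim X1 X := primM (primM pm pm1) (primD (primM f1 f1) (primM h1 h1)).
have X0 : X (c + r) = 0 /\ X (c - r) = 0.
  have [|m0x _ _] := m0 (c + r); first by right.
  have [|m0x' _ _] := m0 (c - r); first by left.
  by rewrite /X m0x m0x' !mul0r.
have pY := primD zZ pX.
have zX t : z t + X1 t = m t ^+ 2 * (f t * (F t - C * f t) + h t * (H t - C * h t)) +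
    (m1 t ^+ 2 + m t ^+ 2) * (f t ^+ 2 + h t ^+ 2) - 2 * m t ^+ 2 * wronskian f h t.
  (* Pairing the two test functions leaves the angle only through this factor, which is 1. *)
  have -> : z t = (cos t ^+ 2 + sin t ^+ 2) *
     (m t * f t * (m t * F t - 2 * m1 t * derive1 f t - m2 t * f t + m t * f t
                   - 2 * m t * derive1 h t - 2 * m1 t * h t - C * (m t * f t)) +
      m t * h t * (m t * H t - 2 * m1 t * derive1 h t - m2 t * h t + m t * h t
                   + 2 * m t * derive1 f t + 2 * m1 t * f t - C * (m t * h t))).
    by rewrite /z /u1 /u2 /g1 /g2 /a /b /a1 /b1 /a2 /b2; ring.
  by rewrite cos2Dsin2 /X1 /wronskian; ring.
have zXle t : z t + X1 t <= e t - 2 * m t ^+ 2 * wronskian f h t.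
  rewrite zX lerD2r.
  have [/andP[mt0 mt1] m1t] := mb t.
  have m2le : m t ^+ 2 <= 1 by rewrite exprn_ile1.
  have m1le : m1 t ^+ 2 <= 36.
    by move: m1t; rewrite ler_norml => /andP[]; nra.
  have tle y : m t ^+ 2 * y <= `|y|.
    rewrite (le_trans (ler_norm _))// normrM ger0_norm ?exprn_ge0//.
    by rewrite ler_piMl.
  have A1 y Y : `|y * (Y - C * y)| <= (y ^+ 2 + Y ^+ 2) + `|C| * y ^+ 2.
    rewrite mulrBr (le_trans (ler_normB _ _))// lerD//.
      by rewrite ler_norml; apply/andP; split; nra.
    by rewrite mulrCA -expr2 normrM (ger0_norm (sqr_ge0 y)).
  have A2 : (m1 t ^+ 2 + m t ^+ 2) * (f t ^+ 2 + h t ^+ 2) <= 37 * (f t ^+ 2 + h t ^+ 2).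
    by rewrite ler_wpM2r ?addr_ge0 ?sqr_ge0//; lra.
  have := A1 (f t) (F t); have := A1 (h t) (H t); have := tle (f t * (F t - C * f t)).
  have := tle (h t * (H t - C * h t)).
  have C0 := normr_ge0 C.
  have := mulr_ge0 C0 (sqr_ge0 (F t)); have := mulr_ge0 C0 (sqr_ge0 (H t)).
  have := sqr_ge0 (F t); have := sqr_ge0 (H t).
  rewrite /e /k mulrDr => *; lra.
have r0 : 0 < r by lra.
have Wpos t : c - r <= t <= c + r -> 0 <= 2 * m t ^+ 2 * wronskian f h t.
  move=> /Wl Wt; have W0 : 0 <= wronskian f h t by lra.
  by rewrite mulr_ge0// mulr_ge0// sqr_ge0.
(* The Wronskian term is dropped on the two outer quarters, where it has a good sign, and kept on
   the middle half, where [m] is bounded below. *)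
have Y1 : Z (c - r / 2) + X (c - r / 2) - (Z (c - r) + X (c - r)) <=
    E (c - r / 2) - E (c - r).
  apply: (prim_le pY eE); first lra.
  by move=> t tr; apply: (le_trans (zXle t)); rewrite gerBl Wpos//; lra.
have Y3 : Z (c + r) + X (c + r) - (Z (c + r / 2) + X (c + r / 2)) <=
    E (c + r) - E (c + r / 2).
  apply: (prim_le pY eE); first lra.
  by move=> t tr; apply: (le_trans (zXle t)); rewrite gerBl Wpos//; lra.
have Y2 : Z (c + r / 2) + X (c + r / 2) - (Z (c - r / 2) + X (c - r / 2)) <=
    E (c + r / 2) - l / 8 * (c + r / 2) - (E (c - r / 2) - l / 8 * (c - r / 2)).
  apply: (prim_le pY (primB eE (primZ (l / 8) prim_id))); first lra.
  move=> t tr; apply: (le_trans (zXle t)); rewrite lerD2l lerN2 mulr1.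
  have /Wl Wt : c - r <= t <= c + r by lra.
  have mt := mq t tr.
  have m16 : 1 / 16 <= m t ^+ 2 by nra.
  have : (1 / 16) * l <= m t ^+ 2 * wronskian f h t by apply: ler_pM; lra.
  by lra.
have := EK (c - r) (c + r); move: Y1 Y2 Y3 Z0; rewrite (proj1 X0) (proj2 X0) => *.
lra.
Qed.

(** The derivative [F h - f H] is bounded by the integrable [s], so far out [W] oscillates by at
    most [e / 2]. A value of modulus above [e] would then keep [|W|] above [e / 2] on intervals of
    any length, against [wronskian_bound]. A negative sign is handled by exchanging [f] and [h]. *)
Lemma wronskian_cvg0 q f F h H : semibounded_below q ->
  ode_sol q f F -> ode_sol q h H -> continuous F -> continuous H ->
  sq_int setT f -> sq_int setT F -> sq_int setT h -> sq_int setT H ->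
  wronskian f h x @[x --> +oo] --> 0 /\ wronskian f h x @[x --> -oo] --> 0.
Proof.
move=> sb sf sh Fc Hc fi Fi hi Hi.
have [K1 b1] := wronskian_bound sb sf sh Fc Hc fi Fi hi Hi.
have [K2 b2] := wronskian_bound sb sh sf Hc Fc hi Hi fi Fi.
have [_ _ fc _] := ode_sol_prim sf; have [_ _ hc _] := ode_sol_prim sh.
have [Uf [pf [Kf bf]]] := sq_int_prim fc fi.
have [UF [pF [KF bF]]] := sq_int_prim Fc Fi.
have [Uh [ph [Kh bh]]] := sq_int_prim hc hi.
have [UH [pH [KH bH]]] := sq_int_prim Hc Hi.
pose s t := f t ^+ 2 + F t ^+ 2 + h t ^+ 2 + H t ^+ 2.
pose S t := Uf t + UF t + Uh t + UH t.
have sS : prim s S := primD (primD (primD pf pF) ph) pH.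
have SK x : 0 <= S x <= Kf + KF + Kh + KH.
  have := bf x; have := bF x; have := bh x; have := bH x; rewrite /S; lra.
have Snd : {homo S : x y / x <= y}.
  by apply: prim_nondecreasing sS _ => t; rewrite /s !addr_ge0 ?sqr_ge0.
have WS a b : a <= b -> `|wronskian f h b - wronskian f h a| <= S b - S a.
  move=> ab; apply: (prim_norm_le (prim_wronskian sf sh) sS ab) => t _.
  have := sqr_ge0 (F t - h t); have := sqr_ge0 (F t + h t).
  have := sqr_ge0 (f t - H t); have := sqr_ge0 (f t + H t).
  by rewrite ler_norml /s => *; apply/andP; split; nra.
have far (e : R) : 0 < e -> exists2 r : R, 1 <= r & forall c, `|wronskian f h c| > e ->
    (forall x, c - r <= x <= c + r -> `|wronskian f h x - wronskian f h c| <= e / 2) ->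
    False.
  (* Chosen so that [e / 2 * r] exceeds both constants [K1] and [K2]. *)
  move=> e0; pose r : R := 1 + 2 * (`|K1| + `|K2| + 1) / e.
  have r1 : 1 <= r by rewrite lerDl divr_ge0 ?mulr_ge0 ?addr_ge0// ltW.
  have er : `|K1| + `|K2| + 1 < e / 2 * r.
    have -> : e / 2 * r = e / 2 + (`|K1| + `|K2| + 1).
      by rewrite /r; field; rewrite gt_eqF.
    lra.
  exists r => // c; rewrite ltr_normr => cE near_c.
  have e20 : 0 < e / 2 by lra.
  have k1 := ler_norm K1; have k2 := ler_norm K2.
  have k10 := normr_ge0 K1; have k20 := normr_ge0 K2.
  case/orP: cE => cE.
    have := b1 c r _ r1 e20 _; have : forall x, c - r <= x <= c + r -> e / 2 <= wronskian f h x.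
      by move=> x /near_c; rewrite ler_norml; lra.
    by move=> H1 /(_ H1); lra.
  have := b2 c r _ r1 e20 _; have : forall x, c - r <= x <= c + r -> e / 2 <= wronskian h f x.
    by move=> x /near_c; rewrite ler_norml wronskianC; lra.
  by move=> H1 /(_ H1); lra.
have supS : has_sup (range S).
  split; [by exists (S 0); exists 0|exists (Kf + KF + Kh + KH) => _ [x _ <-]].
  by have /andP[] := SK x.
have infS : has_inf (range S).
  split; [by exists (S 0); exists 0|exists 0 => _ [x _ <-]].
  by have /andP[] := SK x.
split.
- apply/cvgrPdist_le => e e0; have [r r1 Fr] := far e e0.
  have e20 : 0 < e / 2 by lra.
  have [_ [A _ <-] SA] := sup_adherent e20 supS.
  have tail x y : A <= x -> A <= y -> `|wronskian f h y - wronskian f h x| <= e / 2.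
    have SS z : S z <= sup (range S) by apply: sup_ubound; [case: supS|exists z].
    wlog xy : x y / x <= y.
      by move=> WH Ax Ay; case/orP: (le_total x y) => /WH; [exact|rewrite distrC; exact].
    move=> Ax Ay; apply: (le_trans (WS _ _ xy)).
    have := Snd _ _ Ax; have := SS y; lra.
  near=> x; rewrite sub0r normrN leNgt; apply/negP => xe.
  have Ax : A + r <= x by near: x; apply: nbhs_pinfty_ge; exact: num_real.
  by apply: (Fr x xe) => y yx; apply: tail; lra.
- apply/cvgrPdist_le => e e0; have [r r1 Fr] := far e e0.
  have e20 : 0 < e / 2 by lra.
  have [_ [A _ <-] SA] := inf_adherent e20 infS.
  have tail x y : x <= A -> y <= A -> `|wronskian f h y - wronskian f h x| <= e / 2.
    have SS z : inf (range S) <= S z by apply: ge_inf; [case: infS|exists z].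
    wlog xy : x y / x <= y.
      by move=> WH Ax Ay; case/orP: (le_total x y) => /WH; [exact|rewrite distrC; exact].
    move=> Ax Ay; apply: (le_trans (WS _ _ xy)).
    have := Snd _ _ Ay; have := SS x; lra.
  near=> x; rewrite sub0r normrN leNgt; apply/negP => xe.
  have Ax : x <= A - r by near: x; apply: nbhs_ninfty_le; exact: num_real.
  by apply: (Fr x xe) => y yx; apply: tail; lra.
Unshelve. all: by end_near. Qed.

End LimitPoint.

(** * Unique continuation and linear independence *)

Section UniqueContinuation.
Variable R : realType.
Local Notation mu := (@lebesgue_measure R).
Implicit Types (q u f : R -> R).

Lemma prim_cst_right p P (x t : R) : prim p P -> continuous p -> x < t ->
  (forall s, x < s -> P s = P t) -> p t = 0.
Proof.
move=> pP pc xt Pt.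
have d := prim_is_derive pP (pc t).
have d0 : is_derive t 1 P 0.
  apply: (near_eq_is_derive (f := cst (P t))) (is_derive_cst _ _ _).
  by near=> s; rewrite Pt//; near: s; exact: lt_nbhsr.
by rewrite -(@derive_val _ _ _ _ _ _ _ d) (@derive_val _ _ _ _ _ _ _ d0).
Unshelve. all: by end_near. Qed.

(* Gronwall: the energy [E = u^2 + u'^2] satisfies [|E'| <= k E] with [k] locally
   integrable, hence [E <= m V^n / n!] for all [n], [V] a primitive of [- k]. *)
Lemma ode_unique_left q (l : R) u (a : R) : loc_integrable q -> rsol q l u ->
  u a = 0 -> derive1 u a = 0 -> forall x, x <= a -> u x = 0.
Proof.
move=> qi su ua u'a x xa.
have [u1 u2 uc u'c] := ode_sol_prim su.
pose k t := 1 + `|l| + `|q t|.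
have ki b c : mu.-integrable `[b, c] (EFin \o k).
  apply: (@integrableD _ _ _ mu _ _ (EFin \o cst (1 + `|l|)) (EFin \o (Num.norm \o q))) => //.
    by apply: continuous_integrable; exact: cont_cst.
  exact/integrable_norm/qi.
have [V kV] := prim_exists ki.
pose E t := u t * u t + derive1 u t * derive1 u t.
have pE := primD (primM u1 u1) (primM u2 u2).
have [m Em] : exists m, forall t, x <= t <= a -> E t <= m.
  have Ec : {within `[x, a], continuous E}.
    by apply: continuous_subspaceT; rewrite /E; cont.
  have [c _ cE] := EVT_max xa Ec.
  by exists (E c) => t tx; apply: cE; rewrite in_itv.
have E0 t : 0 <= E t by rewrite addr_ge0// -expr2 sqr_ge0.
have m0 : 0 <= m by rewrite (le_trans (E0 x))// Em// lexx.
pose D t := V a - V t.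
have pD : prim (fun t => - k t) D.
  by apply: prim_ext (primB (prim_cst (V a)) kV) => // t; rewrite sub0r.
have pDn n : prim (fun t => - (n.+1%:R * k t * D t ^+ n)) (fun t => D t ^+ n.+1).
  elim: n => [|n IH]; first by apply: prim_ext pD => t; rewrite ?expr1 ?expr0; ring.
  apply: prim_ext (primM pD IH) => t; last by rewrite -exprS.
  by rewrite [D t ^+ n.+1]exprS -[n.+2%:R]natr1; ring.
have EDn n t : x <= t <= a -> E t <= m * exp_coeff (D t) n.
  elim: n t => [|n IH] t tx; first by rewrite /exp_coeff/= expr0 fact0 divr1 mulr1 Em.
  have ta : t <= a by case/andP: tx.
  have c0 : n.+1%:R != 0 :> R by rewrite pnatr_eq0.
  have := prim_norm_le pE (primN (primZ (m / n.+1`!%:R) (pDn n))) ta.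
  rewrite -/(E a) -/(E t) /E ua u'a mulr0 addr0 sub0r normrN -/(E t).
  rewrite (ger0_norm (E0 t)) {2}/D subrr expr0n/= mulr0 oppr0 sub0r opprK => H.
  rewrite (le_trans (H _))//; last by rewrite /exp_coeff/= mulrA mulrAC.
  move=> s ts {H}; have sx : x <= s <= a by lra.
  (* The derivative of [E] is [2 u u' (1 + q - l)], where [|2 u u'| <= E] and [|1 + q - l| <= k]. *)
  have -> : derive1 u s * u s + u s * derive1 u s +
     ((q s * u s - l * u s) * derive1 u s + derive1 u s * (q s * u s - l * u s)) =
     2 * (u s * derive1 u s) * (1 + q s - l) by ring.
  have -> : - (m / n.+1`!%:R * - (n.+1%:R * k s * D s ^+ n)) = k s * (m * exp_coeff (D s) n).
    rewrite /exp_coeff/= factS natrM; field.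
    by rewrite nat1r c0 pnatr_eq0 -lt0n fact_gt0.
  rewrite normrM mulrC; apply: ler_pM => //.
    rewrite /k (le_trans (ler_normB _ _))// (le_trans (lerD (ler_normD _ _) (lexx _)))//.
    by rewrite normr1; lra.
  apply: le_trans (IH s sx); rewrite /E ler_norml; apply/andP.
  by have := sqr_ge0 (u s - derive1 u s); have := sqr_ge0 (u s + derive1 u s); split; nra.
have lim0 : m * exp_coeff (D x) n @[n --> \oo] --> m * 0.
  by apply: cvgM; [exact: cvg_cst|exact: cvg_exp_coeff].
have Ex : E x <= 0.
  rewrite -(mulr0 m) -(cvg_lim _ lim0)//; apply: limr_ge; first by apply/cvg_ex; eexists; exact: lim0.
  by apply: nearW => n; apply: EDn; rewrite lexx.
move: Ex; rewrite /E -!expr2 => Ex; apply/eqP; rewrite -sqrf_eq0 eq_le sqr_ge0 andbT.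
by have := sqr_ge0 (derive1 u x); lra.
Qed.

(** By linearity the relation extends from powers to polynomials; the one vanishing at every [l j]
    with [j != i] isolates [y i]. *)
Lemma vandermonde_eq0 (N : nat) (l y : 'I_N -> R) : injective l ->
  (forall k, \sum_i y i * l i ^+ k = 0) -> forall i, y i = 0.
Proof.
move=> linj yl i.
pose p : {poly R} := \prod_(j | j != i) ('X - (l j)%:P).
have : \sum_j y j * p.[l j] = 0.
  under eq_bigr do rewrite horner_coef mulr_sumr.
  rewrite exchange_big/= big1// => k _.
  under eq_bigr do rewrite mulrCA.
  by rewrite -mulr_sumr yl mulr0.
rewrite (bigD1 i)//= big1 => [|j ji]; last first.
  by rewrite /p horner_prod (bigD1 j)//= hornerXsubC subrr mul0r mulr0.
rewrite addr0 => /eqP; rewrite mulf_eq0 => /orP[/eqP//|].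
rewrite horner_prod prodf_seq_eq0 => /hasP[j _]; rewrite !hornerE subr_eq0 => /andP[ji].
by move=> /eqP/linj ij; rewrite ij eqxx in ji.
Qed.

(** Applying the operator [k] times to the relation gives [f k], the sum of [c_i l_i^k phi_i], which
    still vanishes to the right of [x]. By Vandermonde each [c_i phi_i] vanishes there, and unique
    continuation forbids [phi_i] to vanish on a half-line. *)
Lemma eigenfunctions_indep q (N : nat) (l : 'I_N -> R) (phi : 'I_N -> R -> R) :
  loc_integrable q -> injective l -> (forall i, rsol q (l i) (phi i)) ->
  (forall i, exists x, phi i x != 0) -> forall (c : 'I_N -> R) (x : R),
  (forall t, x <= t -> \sum_i c i * phi i t = 0) -> forall i, c i = 0.
Proof.
move=> qi linj sphi phin0 c x c0.
pose f k t := \sum_i c i * l i ^+ k * phi i t.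
pose f1 k t := \sum_i c i * l i ^+ k * derive1 (phi i) t.
have pf k : prim (f1 k) (f k).
  by apply: prim_sum => i; apply: primZ; have [] := ode_sol_prim (sphi i).
have pf1 k : prim (fun t => q t * f k t - f k.+1 t) (f1 k).
  apply: prim_ext (prim_sum _ (fun i => primZ (c i * l i ^+ k) _)) => [t||]; first last.
  - by move=> i; have [_ + _ _] := ode_sol_prim (sphi i); apply.
  - by [].
  - rewrite /f mulr_sumr -sumrB; apply: eq_bigr => i _; rewrite exprS; ring.
have phic i : continuous (phi i) by have [] := ode_sol_prim (sphi i).
have fc k : continuous (f k).
  by apply: cont_sum => i; apply: contM => //; exact: cont_cst.
have f1c k : continuous (f1 k) := prim_continuous (pf1 k).
have f0 k t : x < t -> f k t = 0.
  elim: k t => [|k IH] t xt.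
    by rewrite -(c0 t (ltW xt)) /f; apply: eq_bigr => i _; rewrite expr0 mulr1.
  have f10 s : x < s -> f1 k s = 0.
    by move=> xs; apply: (prim_cst_right (pf k) (f1c k) xs) => r xr; rewrite !IH.
  (* The equation yields [f k.+1] only under an integral: its primitive is constant to the right of
     [x], and continuity then gives the pointwise value. *)
  have [S fS] := prim_exists (fun a b => continuous_integrable a b (fc k.+1)).
  apply: (prim_cst_right fS (fc _) xt) => s xs.
  have H a b : x < a -> a <= b -> S b = S a.
    move=> xa ab; apply/eqP; rewrite -subr_eq0; have [_ ->] := fS _ _ ab.
    have [_ E] := pf1 k _ _ ab; rewrite f10 ?f10 ?subrr// in E; last exact: lt_le_trans ab.
    rewrite -oppr_eq0; apply/eqP; rewrite [RHS]E -mulN1r !integE -RintegralZl//; last first.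
      exact: continuous_integrable.
    apply: eq_Rintegral => r; rewrite inE/= in_itv/= => /andP[ar _].
    by rewrite IH ?(lt_le_trans xa)//; ring.
  by case/orP: (le_total s t) => st; [rewrite (H s t)|rewrite (H t s)].
move=> i; apply/eqP/negPn/negP => ci0.
have phi0 t : x < t -> phi i t = 0.
  move=> xt; apply/eqP; have := @vandermonde_eq0 N l (fun j => c j * phi j t) linj _ i.
  have H k : \sum_j c j * phi j t * l j ^+ k = 0.
    by apply: etrans (f0 k t xt); apply: eq_bigr => j _; rewrite mulrAC.
  by move=> /(_ H)/eqP; rewrite mulf_eq0 (negbTE ci0).
have [p1 _ _ p1c] := ode_sol_prim (sphi i).
have [y /negP[]] := phin0 i; apply/eqP.
have x1 : x < x + 1 by lra.
have [yx|xy] := leP y (x + 1); last by rewrite phi0//; lra.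
apply: (ode_unique_left qi (sphi i) (phi0 _ x1) _ yx).
by apply: (prim_cst_right p1 p1c x1) => s xs; rewrite !phi0.
Qed.

End UniqueContinuation.

(** * Matrix-valued functions *)

Section MatrixDerivative.
Variable R : realType.

Lemma is_derive_continuous (P p : R -> R) :
  (forall x : R, is_derive x 1 P (p x)) -> continuous P.
Proof.
move=> d x; apply: differentiable_continuous; apply/derivable1_diffP.
by case: (d x).
Qed.

Lemma is_derive_bigsum (I : Type) (s : seq I) (f : I -> R -> R) (g : I -> R) (x : R) :
  (forall i, is_derive x 1 (f i) (g i)) ->
  is_derive x 1 (fun y => \sum_(i <- s) f i y) (\sum_(i <- s) g i).
Proof.
move=> fg; elim: s => [|i s IH].
  rewrite big_nil (_ : (fun y => _) = cst 0); first exact: is_derive_cst.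
  by apply/funext => y; rewrite big_nil.
rewrite big_cons (_ : (fun y => _) = f i + (fun y => \sum_(i <- s) f i y)).
  exact: (@is_deriveD _ _ _ _ _ _ _ _ _ (fg i) IH).
by apply/funext => y; rewrite big_cons.
Qed.

Lemma is_derive_bigprod (I : eqType) (s : seq I) (f : I -> R -> R) (g : I -> R) (x : R) :
  uniq s -> (forall i, is_derive x 1 (f i) (g i)) ->
  is_derive x 1 (fun y => \prod_(i <- s) f i y)
    (\sum_(i <- s) g i * \prod_(j <- s | j != i) f j x).
Proof.
move=> us fg; elim: s us => [_|i s IH /=/andP[is_ us]].
  rewrite big_nil (_ : (fun y => _) = cst 1); first exact: is_derive_cst.
  by apply/funext => y; rewrite big_nil.
have := @is_deriveM _ _ _ _ _ _ _ _ (fg i) (IH us).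
rewrite (_ : f i * _ = fun y => \prod_(j <- i :: s) f j y); last first.
  by apply/funext => y; rewrite big_cons.
move=> /is_derive_eq; apply; rewrite /GRing.scale/=.
rewrite big_cons [X in g i * X]big_cons eqxx/= addrC; congr (_ + _).
  rewrite mulrC; congr (_ * _); rewrite big_seq_cond [RHS]big_seq_cond.
  apply: eq_bigl => j; rewrite andbT; case js: (j \in s) => //=.
  by apply/esym/eqP => ji; rewrite -ji js in is_.
rewrite mulr_sumr [LHS]big_seq [RHS]big_seq; apply: eq_bigr => j js.
have ij : i != j by apply/eqP => ij; rewrite ij js in is_.
by rewrite [X in _ = _ * X]big_cons ij mulrCA.
Qed.

(** Jacobi's formula. The Leibniz expansion of the derivative is the sum over [i] of the
    determinants of [A] with row [i] differentiated (the matrix [B]), each expanded along that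
    row. *)
Lemma is_derive_det n (A : R -> 'M[R]_n) (A' : 'M[R]_n) (x : R) :
  (forall i j, is_derive x 1 (fun y => A y i j) (A' i j)) ->
  is_derive x 1 (fun y => \det (A y)) (\tr (A' *m \adj (A x))).
Proof.
move=> dA.
have d1 (s : 'S_n) : is_derive x 1 (fun y => (-1) ^+ s * \prod_i A y i (s i))
    ((-1) ^+ s * \sum_i A' i (s i) * \prod_(j | j != i) A x j (s j)).
  have dp := is_derive_bigprod (index_enum_uniq _) (fun i => dA i (s i)).
  exact: (@is_deriveZ _ _ _ _ ((-1) ^+ s : R) _ _ _ dp).
have := is_derive_bigsum (index_enum _) d1; rewrite /determinant => /is_derive_eq; apply.
under eq_bigr do rewrite mulr_sumr.
rewrite exchange_big/= /mxtrace; apply: eq_bigr => i _.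
pose B := \matrix_(k, j) (if k == i then A' k j else A x k j).
transitivity (\det B).
  rewrite /determinant; apply: eq_bigr => s _; congr (_ * _).
  rewrite [RHS](bigD1 i)//= mxE eqxx; congr (_ * _).
  by apply: eq_bigr => j ji; rewrite mxE (negbTE ji).
rewrite (expand_det_row B i) mxE; apply: eq_bigr => j _; rewrite !mxE eqxx; congr (_ * _).
congr (_ * \det _); apply/matrixP => k l; rewrite !mxE.
by rewrite eq_sym (negbTE (neq_lift _ _)).
Qed.

(** Differentiability is read off the cofactor formula; the value then follows by differentiating
    [A A^-1 = 1]. *)
Lemma is_derive_invmx n (A : R -> 'M[R]_n) (A' : R -> 'M[R]_n) :
  (forall (x : R) i j, is_derive x 1 (fun y => A y i j) (A' x i j)) ->
  (forall x, A x \in unitmx) ->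
  forall (x : R) i j, is_derive x 1 (fun y => invmx (A y) i j)
    ((- (invmx (A x) *m A' x *m invmx (A x))) i j).
Proof.
move=> dA Au x.
have dI i j : derivable (fun y => invmx (A y) i j) x 1.
  have dd := is_derive_det (dA x).
  have d0 : \det (A x) != 0 by move: (Au x); rewrite unitmxE unitfE.
  have dc : derivable (fun y => cofactor (A y) j i) x 1.
    rewrite /cofactor; apply: derivableM; first exact: derivable_cst.
    have := @is_derive_det _ (fun y => row' j (col' i (A y))) (row' j (col' i (A' x))) x.
    by case=> // k l; rewrite !mxE (_ : (fun y => _) = (fun y => A y (lift j k) (lift i l)))//;
      apply/funext => y; rewrite !mxE.
  rewrite (_ : (fun y => _) = (fun y => (\det (A y))^-1 * cofactor (A y) j i)).
    apply: derivableM dc; apply: derivableV => //; by case: dd.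
  by apply/funext => y; rewrite /invmx Au !mxE.
pose I' := \matrix_(i, j) 'D_1 (fun y => invmx (A y) i j) x.
have dI' i j : is_derive x 1 (fun y => invmx (A y) i j) (I' i j).
  by rewrite mxE; apply: DeriveDef.
have E : A' x *m invmx (A x) + A x *m I' = 0.
  apply/matrixP => i j; rewrite !mxE -big_split/=.
  have d1 : is_derive x 1 (fun y => \sum_k A y i k * invmx (A y) k j)
      (\sum_k (A x i k * I' k j + invmx (A x) k j * A' x i k)).
    by apply: is_derive_bigsum => k; exact: (@is_deriveM _ _ _ _ _ _ _ _ (dA x i k) (dI' k j)).
  have d2 : is_derive x 1 (fun y => \sum_k A y i k * invmx (A y) k j) 0.
    rewrite (_ : (fun y => _) = cst ((1%:M : 'M[R]_n) i j)); first exact: is_derive_cst.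
    by apply/funext => y; rewrite -(mulmxV (Au y)) mxE.
  transitivity (\sum_k (A x i k * I' k j + invmx (A x) k j * A' x i k)).
    by apply: eq_bigr => k _; rewrite addrC [X in _ + X]mulrC.
  by rewrite -(@derive_val _ _ _ _ _ _ _ d1) (@derive_val _ _ _ _ _ _ _ d2).
have -> : - (invmx (A x) *m A' x *m invmx (A x)) = I'; last exact: dI'.
have /(congr1 (mulmx (invmx (A x)))) := E.
rewrite mulmx0 mulmxDr mulmxA (mulmxA (invmx _) (A x)) mulVmx// mul1mx.
by move=> /eqP; rewrite addrC addr_eq0 => /eqP ->.
Qed.

End MatrixDerivative.

(** * Primitives of matrix functions, the scalar product, positive definite matrices *)

Section MatrixPrimitive.
Variable R : realType.

Definition mxprim m n (p P : R -> 'M[R]_(m, n)) : Prop :=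
  forall i j, prim (fun x => p x i j) (fun x => P x i j).

Lemma mxprim_ext m n (p r P S : R -> 'M[R]_(m, n)) :
  p =1 r -> P =1 S -> mxprim p P -> mxprim r S.
Proof. by move=> /funext -> /funext ->. Qed.

Lemma mxprimD m n (p r P S : R -> 'M[R]_(m, n)) : mxprim p P -> mxprim r S ->
  mxprim (fun x => p x + r x) (fun x => P x + S x).
Proof. by move=> pP rS i j; apply: prim_ext (primD (pP i j) (rS i j)) => x; rewrite mxE. Qed.

Lemma mxprim_cst m n (A : 'M[R]_(m, n)) : mxprim (fun=> 0) (fun=> A).
Proof. by move=> i j; apply: prim_ext (prim_cst (A i j)) => x; rewrite ?mxE. Qed.

Lemma mxprimZ m n (p P : R -> R) (r S : R -> 'M[R]_(m, n)) : prim p P -> mxprim r S ->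
  mxprim (fun x => p x *: S x + P x *: r x) (fun x => P x *: S x).
Proof. by move=> pP rS i j; apply: prim_ext (primM pP (rS i j)) => x; rewrite !mxE. Qed.

Lemma mxprimM m n k (p P : R -> 'M[R]_(m, n)) (r S : R -> 'M[R]_(n, k)) :
  mxprim p P -> mxprim r S ->
  mxprim (fun x => p x *m S x + P x *m r x) (fun x => P x *m S x).
Proof.
move=> pP rS i j.
apply: prim_ext (prim_sum (index_enum _) (fun l => primM (pP i l) (rS l j))) => x.
  by rewrite !mxE big_split.
by rewrite mxE.
Qed.

Lemma mxprim0_eq m n (P : R -> 'M[R]_(m, n)) : mxprim (fun=> 0) P -> forall x y, P x = P y.
Proof.
move=> P0 x y; apply/matrixP => i j; apply: (@prim0_eq R (fun x => P x i j)).
by apply: prim_ext (P0 i j) => t; rewrite ?mxE.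
Qed.

Lemma mxprim_invmx n (p P : R -> 'M[R]_n) : mxprim p P ->
  (forall i j, continuous (fun x => p x i j)) -> (forall x, P x \in unitmx) ->
  mxprim (fun x => - (invmx (P x) *m p x *m invmx (P x))) (fun x => invmx (P x)).
Proof.
move=> pP pc Pu.
have dI := is_derive_invmx (fun x i j => prim_is_derive (pP i j) (pc i j x)) Pu.
have Ic i j : continuous (fun x => invmx (P x) i j).
  by apply: is_derive_continuous => x; exact: dI.
move=> i j; apply: (is_derive_prim (fun x => dI x i j)).
rewrite (_ : (fun x => _) = fun x => - \sum_k (\sum_l invmx (P x) i l * p x l k) * invmx (P x) k j).
  apply: contN; apply: cont_sum => k; apply: contM => //.
  by apply: cont_sum => l; apply: contM.
by apply/funext => x; rewrite !mxE; congr (- _); apply: eq_bigr => k _; rewrite mxE.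
Qed.

Definition dot n (a b : 'cV[R]_n) : R := \sum_i a i 0 * b i 0.

Lemma prim_dot n (p r P S : R -> 'cV[R]_n) : mxprim p P -> mxprim r S ->
  prim (fun x => dot (p x) (S x) + dot (P x) (r x)) (fun x => dot (P x) (S x)).
Proof.
move=> pP rS.
apply: prim_ext (prim_sum (index_enum _) (fun l => primM (pP l 0) (rS l 0))) => x //.
by rewrite big_split.
Qed.

Lemma dotC n (a b : 'cV[R]_n) : dot a b = dot b a.
Proof. by apply: eq_bigr => i _; rewrite mulrC. Qed.

Lemma dotDl n (a b c : 'cV[R]_n) : dot (a + b) c = dot a c + dot b c.
Proof. by rewrite /dot -big_split; apply: eq_bigr => i _; rewrite mxE mulrDl. Qed.

Lemma dotZl n (k : R) (a b : 'cV[R]_n) : dot (k *: a) b = k * dot a b.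
Proof. by rewrite /dot mulr_sumr; apply: eq_bigr => i _; rewrite mxE mulrA. Qed.

Lemma dotNl n (a b : 'cV[R]_n) : dot (- a) b = - dot a b.
Proof. by rewrite -scaleN1r dotZl mulN1r. Qed.

Lemma dotDr n (a b c : 'cV[R]_n) : dot a (b + c) = dot a b + dot a c.
Proof. by rewrite dotC dotDl !(dotC _ a). Qed.

Lemma dotZr n (k : R) (a b : 'cV[R]_n) : dot a (k *: b) = k * dot a b.
Proof. by rewrite dotC dotZl dotC. Qed.

Lemma dotNr n (a b : 'cV[R]_n) : dot a (- b) = - dot a b.
Proof. by rewrite dotC dotNl dotC. Qed.

Lemma dot0l n (a : 'cV[R]_n) : dot 0 a = 0.
Proof. by rewrite -(scale0r 0) dotZl mul0r. Qed.

Lemma dot0r n (a : 'cV[R]_n) : dot a 0 = 0.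
Proof. by rewrite dotC dot0l. Qed.

Lemma dotMl n (A : 'M[R]_n) (a b : 'cV[R]_n) : dot (A *m a) b = dot a (A^T *m b).
Proof.
rewrite /dot; under eq_bigr do rewrite mxE mulr_suml.
rewrite exchange_big/=; apply: eq_bigr => i _; rewrite mxE mulr_sumr.
by apply: eq_bigr => j _; rewrite mxE mulrCA mulrA.
Qed.

Lemma outer_mulmx n (a b c : 'cV[R]_n) : a *m b^T *m c = dot b c *: a.
Proof.
rewrite -mulmxA; apply/matrixP => i j; rewrite ord1 !mxE big_ord1 mulrC; congr (_ * _).
by rewrite mxE; apply: eq_bigr => k _; rewrite mxE.
Qed.

Lemma dot_eq0 n (a : 'cV[R]_n) : (dot a a == 0) = (a == 0).
Proof.
apply/idP/eqP => [|->]; last by rewrite dot0l.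
rewrite psumr_eq0 => [/allP a0|i _]; last by rewrite -expr2 sqr_ge0.
apply/matrixP => i j; rewrite ord1 mxE; apply/eqP.
by have := a0 i (mem_index_enum _); rewrite -expr2 sqrf_eq0.
Qed.

Lemma dot_ge0 n (a : 'cV[R]_n) : 0 <= dot a a.
Proof. by apply: sumr_ge0 => i _; rewrite -expr2 sqr_ge0. Qed.

Definition posdef n (A : 'M[R]_n) := forall c : 'cV[R]_n, c != 0 -> 0 < dot c (A *m c).

Lemma posdef_det_neq0 n (A : 'M[R]_n) : posdef A -> \det A != 0.
Proof.
move=> Ap; rewrite -det_tr; apply/negP => /det0P[v v0 vA].
have : v^T != 0 by apply: contra v0 => /eqP v0; rewrite -[v]trmxK v0 trmx0.
move=> /Ap; rewrite -[A]trmxK -trmx_mul vA trmx0.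
by rewrite dot0r ltxx.
Qed.

(* the determinant does not vanish on the segment from the identity to [A] *)
Lemma posdef_det_gt0 n (A : 'M[R]_n) : posdef A -> 0 < \det A.
Proof.
move=> Ap; pose B (t : R) := (1 - t)%:M + t *: A.
have Bp t : 0 <= t <= 1 -> posdef (B t).
  move=> /andP[t0 t1] c c0; rewrite mulmxDl mul_scalar_mx -scalemxAl dotDr !dotZr.
  have cc : 0 < dot c c by rewrite lt_def dot_eq0 c0 dot_ge0.
  have cA := Ap c c0.
  have [->|tpos] := eqVneq t 0; first by rewrite subr0 mul1r mul0r addr0.
  rewrite ltr_wpDl ?mulr_ge0 ?subr_ge0 ?(ltW cc)// mulr_gt0// lt_def tpos//.
have Bc : continuous (fun t => \det (B t)).
  have dB (t : R) i j : is_derive t 1 (fun t => B t i j) ((A - 1%:M) i j).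
    have dp : prim (fun=> (A - 1%:M) i j) (fun t => B t i j).
      apply: prim_ext (primB (prim_cst ((1%:M : 'M[R]_n) i j))
        (primZ ((1%:M - A) i j) (prim_id (R := R)))) => s; first by rewrite !mxE; ring.
      by rewrite !mxE mulrnBl; case: (i == j); rewrite ?mulr1n ?mulr0n; ring.
    by apply: (prim_is_derive dp); exact: cont_cst.
  by apply: is_derive_continuous => t; exact: (is_derive_det (dB t)).
rewrite ltNge; apply/negP => dA.
have B01 : Num.min (\det (B 0)) (\det (B 1)) <= 0 <= Num.max (\det (B 0)) (\det (B 1)).
  rewrite /B subr0 scale0r addr0 det1 subrr scale1r (_ : 0%:M = 0) ?add0r; last exact: raddf0.
  by rewrite ge_min le_max dA ler01 orbT.
have [t t01 Bt] := @IVT R (fun t => \det (B t)) 0 1 0 ler01 (continuous_subspaceT Bc) B01.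
have : \det (B t) != 0 by apply/posdef_det_neq0/Bp; move: t01; rewrite in_itv.
by rewrite Bt eqxx.
Qed.

Lemma posdef_unitmx n (A : 'M[R]_n) : posdef A -> A \in unitmx.
Proof. by move=> /posdef_det_gt0; rewrite unitmxE unitfE; exact: lt0r_neq0. Qed.

Lemma posdef_ge0 n (A : 'M[R]_n) c : posdef A -> 0 <= dot c (A *m c).
Proof.
move=> Ap; have [->|/Ap/ltW//] := eqVneq c 0.
by rewrite dot0l.
Qed.

Lemma posdef_invmx n (A : 'M[R]_n) : posdef A -> A^T = A -> posdef (invmx A).
Proof.
move=> Ap As c c0; have Au := posdef_unitmx Ap.
have Ic0 : invmx A *m c != 0.
  by apply: contra c0 => /eqP H; rewrite -[c](mulKVmx Au) H mulmx0.
have := Ap _ Ic0; rewrite mulKVmx// dotC; congr (_ < _); by rewrite dotC.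
Qed.

(** Cauchy-Schwarz in the form [A] for the vectors [c] and [A^-1 c]. It turns [M -> 0] into the
    blow-up of [d.M^-1 d]. *)
Lemma posdef_cauchy n (A : 'M[R]_n) (c : 'cV[R]_n) : posdef A -> A^T = A ->
  dot c c ^+ 2 <= dot c (A *m c) * dot c (invmx A *m c).
Proof.
move=> Ap As; have Au := posdef_unitmx Ap.
(* For nonzero [c], the [t] set next minimizes the form [A] along [t c - A^-1 c]. *)
have [->|c0] := eqVneq c 0; first by rewrite !dot0l mul0r expr0n.
have cA := Ap c c0; set t := dot c c / dot c (A *m c).
have := posdef_ge0 (t *: c - invmx A *m c) Ap.
rewrite mulmxBr -scalemxAr mulKVmx// !dotDl !dotDr !dotNr !dotNl !dotZl !dotZr.
rewrite dotMl trmx_inv As mulKmx//= (dotC _ c) => H.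
rewrite mulrC -ler_pdivrMr//; apply: le_trans (_ : 2 * t * dot c c - t * (t * dot c (A *m c)) <= _).
  by rewrite /t le_eqVlt; apply/orP; left; apply/eqP; field; rewrite gt_eqF.
lra.
Qed.

Lemma cvg_bigsum (T : Type) (F : set_system T) {FF : Filter F} (I : Type) (r : seq I)
    (f : I -> T -> R) (l : I -> R) :
  (forall i, f i x @[x --> F] --> l i) ->
  \sum_(i <- r) f i x @[x --> F] --> \sum_(i <- r) l i.
Proof.
move=> fl; elim: r => [|i r IH].
  rewrite big_nil (_ : (fun x => _) = cst 0); first exact: cvg_cst.
  by apply/funext => x; rewrite big_nil.
rewrite big_cons (_ : (fun x => _) = fun x => f i x + \sum_(j <- r) f j x).
  exact: cvgD.
by apply/funext => x; rewrite big_cons.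
Qed.

Lemma cvg_mulmx_col (T : Type) (F : set_system T) {FF : Filter F} n
    (A : T -> 'M[R]_n) (L : 'M[R]_n) (c : 'cV[R]_n) :
  (forall i j, A x i j @[x --> F] --> L i j) ->
  forall i, (A x *m c) i 0 @[x --> F] --> (L *m c) i 0.
Proof.
move=> AL i; rewrite mxE (_ : (fun x => _) = fun x => \sum_j A x i j * c j 0).
  by apply: cvg_bigsum => j; apply: cvgM; [exact: AL|exact: cvg_cst].
by apply/funext => x; rewrite mxE.
Qed.

Lemma cvg_dot (T : Type) (F : set_system T) {FF : Filter F} n
    (c : 'cV[R]_n) (v : T -> 'cV[R]_n) (l : 'cV[R]_n) :
  (forall i, v x i 0 @[x --> F] --> l i 0) ->
  dot c (v x) @[x --> F] --> dot c l.
Proof.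
by move=> vl; apply: cvg_bigsum => i; apply: cvgM; [exact: cvg_cst|exact: vl].
Qed.

(** Evaluates a conserved quantity by its limit at an infinity. *)
Lemma prim0_cvg (F : set_system R) {FF : ProperFilter F} (P : R -> R) (l : R) :
  prim (fun=> 0) P -> P x @[x --> F] --> l -> forall x, P x = l.
Proof.
move=> P0 Pl x; have PE : P = cst (P x) by apply/funext => y; exact: prim0_eq.
by rewrite PE in Pl; rewrite -(cvg_lim _ Pl)// lim_cst.
Qed.

End MatrixPrimitive.

(** * Closure properties of square integrable functions *)

Section SquareIntegrable.
Variable R : realType.
Local Notation mu := (@lebesgue_measure R).
Implicit Types u v : R -> R.

Lemma sq_intM u v : continuous u -> continuous v -> sq_int setT u -> sq_int setT v ->
  mu.-integrable setT (EFin \o (fun t => u t * v t)).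
Proof.
move=> uc vc ui vi.
have uvc : continuous (fun t => u t * v t) by cont.
apply: (@le_integrable _ _ _ mu _ measurableT _ (EFin \o (fun t => u t ^+ 2 + v t ^+ 2))).
- by apply/measurable_EFinP; exact: continuous_measurable_fun.
- move=> t _ /=; rewrite lee_fin [leRHS]ger0_norm ?addr_ge0 ?sqr_ge0//.
  have := sqr_ge0 (u t - v t); have := sqr_ge0 (u t + v t).
  by rewrite ler_norml => *; apply/andP; split; nra.
- exact: (@integrableD _ _ _ mu _ _ _ _ ui vi).
Qed.

Lemma sq_intD u v : continuous u -> continuous v -> sq_int setT u -> sq_int setT v ->
  sq_int setT (fun t => u t + v t).
Proof.
move=> uc vc ui vi.
have uvc : continuous (fun t => (u t + v t) ^+ 2) by cont.
have ii := @integrableD _ _ _ mu _ measurableT _ _ ui vi.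
apply: (@le_integrable _ _ _ mu _ measurableT _
  (EFin \o (fun t => 2 * (u t ^+ 2 + v t ^+ 2)))).
- by apply/measurable_EFinP; exact: continuous_measurable_fun.
- move=> t _ /=; have A : 0 <= 2 * (u t ^+ 2 + v t ^+ 2).
    by rewrite mulr_ge0// addr_ge0// sqr_ge0.
  rewrite lee_fin (ger0_norm (sqr_ge0 _)) (ger0_norm A).
  by have := sqr_ge0 (u t - v t); nra.
- exact: (@integrableZl _ _ _ mu _ measurableT 2 _ ii).
Qed.

Lemma sq_intZ (c : R) u : sq_int setT u -> sq_int setT (fun t => c * u t).
Proof.
move=> ui; rewrite /sq_int.
rewrite (_ : EFin \o _ = EFin \o (fun t => c ^+ 2 * u t ^+ 2)).
  exact: (@integrableZl _ _ _ mu _ measurableT (c ^+ 2) _ ui).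
by apply/funext => t; rewrite /= exprMn.
Qed.

Lemma sq_int_bigsum (I : Type) (r : seq I) (f : I -> R -> R) :
  (forall i, continuous (f i)) -> (forall i, sq_int setT (f i)) ->
  sq_int setT (fun t => \sum_(i <- r) f i t).
Proof.
move=> fc fi; elim: r => [|i r IH].
  rewrite /sq_int (_ : EFin \o _ = EFin \o cst 0).
    exact: (integrable0 mu).
  by apply/funext => t; rewrite /= big_nil expr0n.
rewrite (_ : (fun t => _) = fun t => f i t + \sum_(j <- r) f j t).
  by apply: sq_intD => //; exact: cont_sum.
by apply/funext => t; rewrite big_cons.
Qed.

End SquareIntegrable.

(** * Double commutation *)

Section Potential.
Variables (R : realType) (N : nat) (q : R -> R) (lam : 'I_N -> R) (phi : 'I_N -> R -> R).
Hypothesis qi : loc_integrable q.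
Hypothesis sb : semibounded_below q.
Hypothesis lamI : injective lam.
Hypothesis sphi : forall n, rsol q (lam n) (phi n).
Hypothesis iphi : forall n, sq_int setT (phi n).
Hypothesis phin0 : forall n, exists x, phi n x != 0.
Hypothesis onphi : orthonormal_set phi.
Local Notation mu := (@lebesgue_measure R).

Definition evec (x : R) : 'cV[R]_N := \col_i phi i x.
Definition devec (x : R) : 'cV[R]_N := \col_i derive1 (phi i) x.
Definition Mmx (x : R) : 'M[R]_N := 1%:M - Gminus phi x.
Definition Lmx : 'M[R]_N := diag_mx (\row_i lam i).
Definition tvec (x : R) : 'cV[R]_N := invmx (Mmx x) *m evec x.
Definition sfun (x : R) : R := dot (evec x) (tvec x).
(** The derivative of [t]: since [(M^-1)' = t t^T], the factor [M^-1] contributes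
    [t (t.phi) = s t]. *)
Definition dtvec (x : R) : 'cV[R]_N := sfun x *: tvec x + invmx (Mmx x) *m devec x.
Definition dsfun (x : R) : R := dot (devec x) (tvec x) + dot (evec x) (dtvec x).

Lemma phi_continuous i : continuous (phi i).
Proof. by have [] := ode_sol_prim (sphi i). Qed.

Lemma LmxE (c : 'cV[R]_N) i : (Lmx *m c) i 0 = lam i * c i 0.
Proof. by rewrite mul_diag_mx !mxE. Qed.

Lemma mxprim_evec : mxprim devec evec.
Proof.
move=> i j; have [p _ _ _] := ode_sol_prim (sphi i).
by apply: prim_ext p => x; rewrite mxE.
Qed.

Lemma mxprim_devec : mxprim (fun x => q x *: evec x - Lmx *m evec x) devec.
Proof.
move=> i j; have [_ p _ _] := ode_sol_prim (sphi i).
apply: prim_ext p => x; last by rewrite mxE.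
by rewrite (ord1 j) [RHS]mxE [X in _ = _ + X]mxE LmxE !mxE.
Qed.

Lemma phi_integrable i j : mu.-integrable setT (EFin \o (fun t => phi i t * phi j t)).
Proof. by apply: sq_intM => //; exact: phi_continuous. Qed.

Lemma integ_phi i j : integ setT (fun t => phi i t * phi j t) = (i == j)%:R.
Proof. by rewrite /integ onphi. Qed.

Lemma mxprim_Mmx : mxprim (fun x => - (evec x *m (evec x)^T)) Mmx.
Proof.
move=> i j; apply: prim_ext (primB (prim_cst ((1%:M : 'M[R]_N) i j))
  (prim_integral (phi_integrable i j))) => x.
  by rewrite sub0r !mxE big_ord1 !mxE.
by rewrite !mxE.
Qed.

Lemma Mmx_tr x : (Mmx x)^T = Mmx x.
Proof.
apply/matrixP => i j; rewrite !mxE eq_sym; congr (_ - _).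
by rewrite /integ; congr fine; apply: eq_integral => t _; rewrite mulrC.
Qed.

Lemma cvgy_Mmx i j : Mmx x i j @[x --> +oo] --> (0 : 'M[R]_N) i j.
Proof.
rewrite mxE -(subrr ((i == j)%:R : R)).
rewrite (_ : (fun x => _) = fun x => (i == j)%:R - integ `]-oo, x] (fun t => phi i t * phi j t)).
  by apply: cvgB; [exact: cvg_cst|rewrite -integ_phi; exact: cvgy_integral (phi_integrable i j)].
by apply/funext => x; rewrite !mxE.
Qed.

Lemma cvgNy_Mmx i j : Mmx x i j @[x --> -oo] --> (1%:M : 'M[R]_N) i j.
Proof.
rewrite -[X in _ --> X]subr0.
rewrite (_ : (fun x => _) = fun x => (1%:M : 'M[R]_N) i j - integ `]-oo, x] (fun t => phi i t * phi j t)).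
  by apply: cvgB; [exact: cvg_cst|exact: cvgNy_integral (phi_integrable i j)].
by apply/funext => x; rewrite !mxE.
Qed.

Lemma wronskian_phi_cvg0 i u f : ode_sol q u f -> continuous f ->
  sq_int setT u -> sq_int setT f ->
  wronskian (phi i) u x @[x --> +oo] --> 0 /\ wronskian (phi i) u x @[x --> -oo] --> 0.
Proof.
move=> su fc ui fi; apply: (wronskian_cvg0 sb (sphi i) su) => //.
- by apply: contM; [exact: cont_cst|exact: phi_continuous].
- exact: sq_intZ.
Qed.

(** Entrywise, [(lam_i - lam_j) M_ij + W(phi_i, phi_j)] has derivative 0 and tends to 0 at +oo, by
    orthonormality and the limit point property. *)
Lemma Lmx_comm x : Lmx *m Mmx x - Mmx x *m Lmx =
  devec x *m (evec x)^T - evec x *m (devec x)^T.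
Proof.
apply/matrixP => i j.
rewrite mul_diag_mx mul_mx_diag !mxE !big_ord1 !mxE.
set G := integ _ _.
have pW := prim_wronskian (sphi i) (sphi j).
have pG := prim_integral (phi_integrable i j).
have p0 : prim (fun=> 0) (fun x => (lam i - lam j) *
    ((i == j)%:R - integ `]-oo, x] (fun t => phi i t * phi j t)) + wronskian (phi i) (phi j) x).
  apply: prim_ext (primD (primZ (lam i - lam j) (primB (prim_cst ((i == j)%:R : R)) pG)) pW) => // t.
  by ring.
have c0 : (lam i - lam j) * ((i == j)%:R - integ `]-oo, x] (fun t => phi i t * phi j t))
    + wronskian (phi i) (phi j) x @[x --> +oo] --> (lam i - lam j) * 0 + 0.
  apply: cvgD.
    apply: cvgM; first exact: cvg_cst.
    rewrite -(subrr ((i == j)%:R : R)).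
    by apply: cvgB; [exact: cvg_cst|rewrite -integ_phi; exact: cvgy_integral (phi_integrable i j)].
  apply: (proj1 (wronskian_phi_cvg0 i (sphi j) _ (iphi j) _)).
    by apply: contM; [exact: cont_cst|exact: phi_continuous].
  exact: sq_intZ.
have H : (lam i - lam j) * ((i == j)%:R - G) + wronskian (phi i) (phi j) x =
    (lam i - lam j) * 0 + 0 by exact: (prim0_cvg p0 c0 x).
by move: H; rewrite /wronskian; lra.
Qed.

(** Hence [c.M(x) c] decreases, from [c.c] at -oo to 0 at +oo. The estimates on [M] below rest on
    this. *)
Lemma prim_quad_Mmx (c : 'cV[R]_N) :
  prim (fun x => - (dot c (evec x) ^+ 2)) (fun x => dot c (Mmx x *m c)).
Proof.
apply: prim_ext (prim_dot (mxprim_cst c) (mxprimM mxprim_Mmx (mxprim_cst c))) => x //.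
rewrite dot0l add0r mulmx0 addr0 mulNmx dotNr outer_mulmx dotZr (dotC (evec x)).
by rewrite expr2.
Qed.

Lemma cvgy_quad_Mmx (c : 'cV[R]_N) : dot c (Mmx x *m c) @[x --> +oo] --> 0.
Proof.
rewrite -(dot0r c) -(mul0mx _ c).
by apply: cvg_dot; apply: cvg_mulmx_col => i j; exact: cvgy_Mmx.
Qed.

Lemma cvgNy_quad_Mmx (c : 'cV[R]_N) : dot c (Mmx x *m c) @[x --> -oo] --> dot c c.
Proof.
rewrite -[X in _ --> dot c X]mul1mx.
by apply: cvg_dot; apply: cvg_mulmx_col => i j; exact: cvgNy_Mmx.
Qed.

Lemma quad_Mmx_nonincreasing (c : 'cV[R]_N) x y : x <= y ->
  dot c (Mmx y *m c) <= dot c (Mmx x *m c).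
Proof.
move=> xy; rewrite -lerN2; have := prim_nondecreasing (primN (prim_quad_Mmx c)).
by move=> /(_ _ _ _ xy); apply => t; rewrite opprK sqr_ge0.
Qed.

Lemma quad_Mmx_le (c : 'cV[R]_N) x : dot c (Mmx x *m c) <= dot c c.
Proof.
rewrite -(cvg_lim _ (cvgNy_quad_Mmx (c := c)))//; apply: limr_ge.
  by apply/cvg_ex; eexists; exact: cvgNy_quad_Mmx.
near=> y; apply: quad_Mmx_nonincreasing; near: y.
by apply: nbhs_ninfty_le; exact: num_real.
Unshelve. all: by end_near. Qed.

Lemma quad_Mmx_ge0 (c : 'cV[R]_N) x : 0 <= dot c (Mmx x *m c).
Proof.
rewrite -(cvg_lim _ (cvgy_quad_Mmx c))//; apply: limr_le.
  by apply/cvg_ex; eexists; exact: cvgy_quad_Mmx.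
near=> y; apply: quad_Mmx_nonincreasing; near: y.
by apply: nbhs_pinfty_ge; exact: num_real.
Unshelve. all: by end_near. Qed.

(** If [c.M(x) c = 0], monotonicity keeps the form at 0 beyond [x], so its derivative [- (c.phi)^2]
    vanishes there, and the independence of eigenfunctions on a half-line gives [c = 0]. *)
Lemma Mmx_posdef x : posdef (Mmx x).
Proof.
move=> c c0; rewrite lt_def quad_Mmx_ge0 andbT; apply: contra c0 => /eqP cx0.
have cy0 y : x <= y -> dot c (Mmx y *m c) = 0.
  by move=> xy; apply/eqP; rewrite eq_le quad_Mmx_ge0 andbT -cx0 quad_Mmx_nonincreasing.
have pc : continuous (fun t => - (dot c (evec t) ^+ 2)).
  apply: contN; apply: contX; apply: cont_sum => i; apply: contM; first exact: cont_cst.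
  rewrite (_ : (fun t => _) = phi i); first exact: phi_continuous.
  by apply/funext => t; rewrite mxE.
(* [prim_cst_right] reaches only points strictly beyond [x], while a closed half-line is asked for
   here; hence [x + 1]. *)
have H := eigenfunctions_indep qi lamI sphi phin0 (c := fun i => c i 0) (x := x + 1).
apply/eqP/matrixP => i j; rewrite (ord1 j) mxE; apply: H => t xt.
have xt' : x < t by lra.
have /eqP := prim_cst_right (prim_quad_Mmx c) pc xt' (fun s xs =>
   etrans (cy0 s (ltW xs)) (esym (cy0 t (ltW xt')))).
rewrite oppr_eq0 sqrf_eq0 => /eqP; apply: etrans.
by apply: eq_bigr => k _; rewrite mxE.
Qed.

Lemma Mmx_unit x : Mmx x \in unitmx.
Proof. exact/posdef_unitmx/Mmx_posdef. Qed.

Lemma invmx_Mmx_tr x : (invmx (Mmx x))^T = invmx (Mmx x).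
Proof. by rewrite trmx_inv Mmx_tr. Qed.

Lemma invmx_Mmx_posdef x : posdef (invmx (Mmx x)).
Proof. exact: posdef_invmx (Mmx_posdef x) (Mmx_tr x). Qed.

Lemma mulmx_tvec x : Mmx x *m tvec x = evec x.
Proof. by rewrite mulKVmx ?Mmx_unit. Qed.

Lemma mxprim_invmx_Mmx : mxprim (fun x => tvec x *m (tvec x)^T) (fun x => invmx (Mmx x)).
Proof.
apply: mxprim_ext (mxprim_invmx mxprim_Mmx _ Mmx_unit) => // [x|i j].
  rewrite mulmxN mulNmx opprK /tvec trmx_mul invmx_Mmx_tr.
  by rewrite !mulmxA.
rewrite (_ : (fun x => _) = fun x => - (phi i x * phi j x)).
  by apply: contN; apply: contM; exact: phi_continuous.
by apply/funext => x; rewrite !mxE big_ord1 !mxE.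
Qed.

Lemma mxprim_tvec : mxprim dtvec tvec.
Proof.
apply: mxprim_ext (mxprimM mxprim_invmx_Mmx mxprim_evec) => // x.
by rewrite outer_mulmx dotC.
Qed.

Lemma prim_sfun : prim dsfun sfun.
Proof. exact: prim_dot mxprim_evec mxprim_tvec. Qed.

Lemma dsfunE x : dsfun x = 2 * dot (devec x) (tvec x) + sfun x ^+ 2.
Proof.
rewrite /dsfun /dtvec dotDr dotZr -/(sfun x) (dotC _ (_ *m devec x)) dotMl invmx_Mmx_tr.
by rewrite -/(tvec x); ring.
Qed.

(** Each [t_i] thus solves the transformed equation at [lam_i]. The term to rearrange is
    [M^-1 L phi = M^-1 L M t]: the commutator [Lmx_comm] moves [L] past [M], at the cost of terms
    that the formula for [s'] absorbs. *)
Lemma mxprim_dtvec :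
  mxprim (fun x => (q x + 2 * dsfun x) *: tvec x - Lmx *m tvec x) dtvec.
Proof.
apply: mxprim_ext (mxprimD (mxprimZ prim_sfun mxprim_tvec)
  (mxprimM mxprim_invmx_Mmx mxprim_devec)) => // x.
have LM : invmx (Mmx x) *m (Lmx *m evec x) =
    Lmx *m tvec x + sfun x *: (invmx (Mmx x) *m devec x) - dot (devec x) (tvec x) *: tvec x.
  have /eqP := Lmx_comm x; rewrite subr_eq => /eqP E.
  rewrite -{1}mulmx_tvec (mulmxA Lmx) E.
  rewrite (mulmxDl (_ - _) (Mmx x *m Lmx)) mulmxBl !outer_mulmx mulmxDr mulmxBr.
  rewrite -!scalemxAr -(mulmxA (Mmx x)) mulKmx ?Mmx_unit// -/(tvec x) -/(sfun x).
  by rewrite addrC addrA.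
rewrite outer_mulmx mulmxBr -scalemxAr LM -/(tvec x) {1}/dtvec.
apply/matrixP => i j; rewrite (ord1 j) dsfunE (dotC (tvec x)).
move: (Lmx *m tvec x) (invmx (Mmx x) *m devec x) (dot _ _) => a b d.
by rewrite !mxE; ring.
Qed.

Lemma tvec_continuous i : continuous (fun x => tvec x i 0).
Proof. exact: prim_continuous (mxprim_tvec i 0). Qed.

Lemma dtvec_continuous i : continuous (fun x => dtvec x i 0).
Proof. exact: prim_continuous (mxprim_dtvec i 0). Qed.

Lemma dsfun_continuous : continuous dsfun.
Proof.
apply: contD; apply: cont_sum => i; apply: contM.
- exact: prim_continuous (mxprim_devec i 0).
- exact: tvec_continuous.
- exact: prim_continuous (mxprim_evec i 0).
- exact: dtvec_continuous.
Qed.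

(** By Jacobi's formula the logarithmic derivative is the trace of [M' M^-1], and
    [M' = - phi phi^T]. *)
Lemma derive1_ln_det : derive1 (fun y => ln (\det (1%:M - Gminus phi y))) = (fun x => - sfun x).
Proof.
apply/funext => x.
have dM i j : is_derive x 1 (fun y => Mmx y i j) ((- (evec x *m (evec x)^T)) i j).
  apply: (prim_is_derive (mxprim_Mmx i j)).
  rewrite (_ : (fun x => _) = fun x => - (phi i x * phi j x)).
    by move: x; apply: contN; apply: contM; exact: phi_continuous.
  by apply/funext => y; rewrite !mxE big_ord1 !mxE.
have M0 := posdef_det_gt0 (Mmx_posdef x).
have := @is_derive1_comp R (@ln R) (fun y => \det (Mmx y)) x _ _
  (is_derive1_ln M0) (is_derive_det dM).
rewrite -[fun y => ln _]/(@ln R \o (fun y => \det (Mmx y))) => d.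
rewrite derive1E (@derive_val _ _ _ _ _ _ _ d).
have -> : \adj (Mmx x) = \det (Mmx x) *: invmx (Mmx x).
  by rewrite /invmx Mmx_unit scalerA divff ?gt_eqF// scale1r.
rewrite -scalemxAr mxtraceZ mulKf ?gt_eqF// mulNmx linearN/= -mulmxA mxtrace_mulC.
congr (- _); rewrite /mxtrace big_ord1 -mulmxA -/(tvec x).
by rewrite mxE; apply: eq_bigr => i _; rewrite mxE.
Qed.

(** The equality holds at every point, not merely almost everywhere, because [s'] is continuous. *)
Lemma q_minusNE : q_minusN q phi = fun x => q x + 2 * dsfun x.
Proof.
apply/funext => x; rewrite /q_minusN derive1_ln_det derive1E.
have d := prim_is_derive (primN prim_sfun) (contN dsfun_continuous (x := x)).
by rewrite (@derive_val _ _ _ _ _ _ _ d) mulrN opprK.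
Qed.

(** * Forward transform: eigenfunctions of [q] give eigenfunctions of q_{-N} *)

Section ForwardTransform.
Variables (l : R) (u : R -> R).
Hypothesis lamNl : forall n, lam n != l.
Hypothesis su : rsol q l u.
Hypothesis ui : sq_int setT u.

(** Among the primitives of [u phi_i], this one vanishes at both infinities: [tsol_sq_int] uses the
    limit at +oo, [tsol_eq0] the one at -oo. *)
Definition wvec (x : R) : 'cV[R]_N := \col_i (wronskian (phi i) u x / (lam i - l)).
Definition tsol (x : R) : R := u x + dot (tvec x) (wvec x).

Lemma mxprim_wvec : mxprim (fun x => u x *: evec x) wvec.
Proof.
move=> i j; have l0 : lam i - l != 0 by rewrite subr_eq0.
apply: prim_ext (primZ (lam i - l)^-1 (prim_wronskian (sphi i) su)) => x.
  by rewrite !mxE; field.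
by rewrite mxE mulrC.
Qed.

Lemma wvec_cvg0 i : wvec x i 0 @[x --> +oo] --> (0 : 'cV[R]_N) i 0 /\
  wvec x i 0 @[x --> -oo] --> (0 : 'cV[R]_N) i 0.
Proof.
have [_ _ uc _] := ode_sol_prim su.
have luc : continuous (fun t => l * u t) by cont.
have [H1 H2] := wronskian_phi_cvg0 i su luc ui (sq_intZ l ui).
rewrite mxE -[X in _ --> X](mul0r (lam i - l)^-1).
rewrite -[X in _ /\ (_ --> X)](mul0r (lam i - l)^-1).
rewrite (_ : (fun x => _) = fun x => wronskian (phi i) u x / (lam i - l)); last first.
  by apply/funext => x; rewrite mxE.
by split; apply: cvgM => //; exact: cvg_cst.
Qed.

Lemma tsol_rsol : rsol (fun x => q x + 2 * dsfun x) l tsol.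
Proof.
have [u1 u2 uc u'c] := ode_sol_prim su.
have p1 : prim (fun x => derive1 u x + dot (dtvec x) (wvec x) + u x * sfun x) tsol.
  apply: prim_ext (primD u1 (prim_dot mxprim_tvec mxprim_wvec)) => // x.
  by rewrite dotZr (dotC (tvec x)) addrA.
apply: (proj1 (ode_sol_intro p1 _)).
apply: prim_ext (primD (primD u2 (prim_dot mxprim_dtvec mxprim_wvec)) (primM u1 prim_sfun)) => // x.
(* Moving [L] from [t] onto [w] produces [l w] and Wronskian terms. Of these [u' s] cancels, and
   [u phi'.t] joins [u phi.t'] to give the second copy of [u s']. *)
have Lv : Lmx *m wvec x = l *: wvec x + (derive1 u x *: evec x - u x *: devec x).
  apply/matrixP => i j; rewrite (ord1 j) LmxE !mxE /wronskian.
  by field; rewrite subr_eq0.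
have LT : (Lmx^T = Lmx)%R by exact: tr_diag_mx.
have E1 : dot (Lmx *m tvec x) (wvec x) =
    l * dot (tvec x) (wvec x) + derive1 u x * sfun x - u x * dot (devec x) (tvec x).
  rewrite dotMl LT Lv !dotDr dotNr !dotZr (dotC (tvec x) (evec x)) (dotC (tvec x) (devec x)).
  by rewrite -/(sfun x) addrA.
rewrite dotDl dotNl E1 dotZl dotZr /tsol /dsfun (dotC (dtvec x) (evec x)); ring.
Qed.

Lemma tsol_continuous : continuous tsol.
Proof. by have [] := ode_sol_prim tsol_rsol. Qed.

Lemma prim_tsol_sq U : prim (fun t => u t ^+ 2) U ->
  prim (fun t => tsol t ^+ 2) (fun t => U t + dot (wvec t) (invmx (Mmx t) *m wvec t)).
Proof.
move=> pU.
apply: prim_ext (primD pU (prim_dot mxprim_wvec (mxprimM mxprim_invmx_Mmx mxprim_wvec))) => // x.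
rewrite -scalemxAr outer_mulmx dotDr !dotZr !dotZl.
rewrite (dotC (evec x)) dotMl invmx_Mmx_tr -/(tvec x) (dotC (wvec x) (tvec x)) /tsol.
by ring.
Qed.

(** The primitive of [tsol^2] contains [w.M^-1 w], a product of factors that vanish and blow up at
    +oo. It is the maximum over [c] of [2 c.w - c.M c]; with [c] frozen at the maximizer for [b],
    the expression can be compared with its limit at +oo. *)
Lemma tsol_sq_int : sq_int setT tsol.
Proof.
have [_ _ uc _] := ode_sol_prim su.
have [U [pU [K UK]]] := sq_int_prim uc ui.
apply: (prim_sq_int (K := K) tsol_continuous (prim_tsol_sq pU)) => a b ab.
have a0 : 0 <= U a + dot (wvec a) (invmx (Mmx a) *m wvec a).
  by rewrite addr_ge0//; [case/andP: (UK a)|exact: posdef_ge0 (invmx_Mmx_posdef a)].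
suff : U b + dot (wvec b) (invmx (Mmx b) *m wvec b) <= K by lra.
(* [U + 2 c.v - c.Mc] is nondecreasing, its derivative being [(u + c.phi)^2] *)
set c := invmx (Mmx b) *m wvec b.
have pF := primB (primD pU (primZ 2 (prim_dot (mxprim_cst c) mxprim_wvec))) (prim_quad_Mmx c).
have Fnd := prim_nondecreasing pF.
have {}Fnd : {homo (fun x => U x + 2 * dot c (wvec x) - dot c (Mmx x *m c)) : x y / x <= y}.
  apply: Fnd => t; rewrite dot0l add0r dotZr.
  by have := sqr_ge0 (u t + dot c (evec t)); nra.
have Fb : U b + dot (wvec b) c = U b + 2 * dot c (wvec b) - dot c (Mmx b *m c).
  by rewrite /c mulKVmx ?Mmx_unit// -/c (dotC _ c); ring.
have lim0 : 2 * dot c (wvec x) - dot c (Mmx x *m c) @[x --> +oo] --> (2 * 0 - 0 : R).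
  apply: cvgB; last exact: cvgy_quad_Mmx.
  apply: cvgM; first exact: cvg_cst.
  by rewrite -(dot0r c); apply: cvg_dot => i; exact: (proj1 (wvec_cvg0 i)).
rewrite -subr_le0 (_ : 0 = (2 * 0 - 0 : R)); last by ring.
rewrite -(cvg_lim _ lim0)//; apply: limr_ge; first by apply/cvg_ex; eexists; exact: lim0.
near=> y; have by_ : b <= y by near: y; apply: nbhs_pinfty_ge; exact: num_real.
rewrite lerBlDl Fb; apply: le_trans (Fnd _ _ by_) _.
by rewrite -addrA lerD2r; case/andP: (UK y).
Unshelve. all: by end_near. Qed.

(** The derivative of [M^-1 w] is [tsol] times [t], so here [w = M c] with [c] constant. At -oo, [w]
    tends to 0 and [M] to the identity, whence [c = 0]. *)
Lemma tsol_eq0 : (forall x, tsol x = 0) -> forall x, u x = 0.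
Proof.
move=> t0.
have pNv : mxprim (fun=> 0) (fun x => invmx (Mmx x) *m wvec x).
  apply: mxprim_ext (mxprimM mxprim_invmx_Mmx mxprim_wvec) => // x.
  rewrite outer_mulmx -scalemxAr -/(tvec x) -scalerDl addrC.
  by have := t0 x; rewrite /tsol => ->; rewrite scale0r.
pose c := invmx (Mmx 0) *m wvec 0.
have vE x : wvec x = Mmx x *m c.
  by rewrite /c (mxprim0_eq pNv 0 x) mulKVmx ?Mmx_unit.
have c0 i : c i 0 = 0.
  have lc : (Mmx x *m c) i 0 @[x --> -oo] --> (1%:M *m c) i 0.
    by apply: cvg_mulmx_col => k j; exact: cvgNy_Mmx.
  rewrite mul1mx in lc.
  have := proj2 (wvec_cvg0 i); rewrite mxE.
  rewrite (_ : (fun x => _) = fun x => (Mmx x *m c) i 0); last by apply/funext => x; rewrite vE.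
  by move=> l0; rewrite -(cvg_lim _ lc)// (cvg_lim _ l0).
have {}c0 : c = 0 by apply/matrixP => i j; rewrite (ord1 j) c0 mxE.
move=> x; have := t0 x; rewrite /tsol vE c0 mulmx0 dot0r addr0.
by [].
Qed.

Lemma tsol_eigenfun : (exists x, u x != 0) -> eigenfun (fun x => q x + 2 * dsfun x) l tsol.
Proof.
move=> [x ux]; split; first exact: tsol_rsol.
split; first exact: tsol_sq_int.
apply/not_existsP => H; move: ux; rewrite tsol_eq0 ?eqxx// => y.
by apply/eqP/negPn/negP; exact: H.
Qed.

End ForwardTransform.

(** * Backward transform: eigenfunctions of q_{-N} give eigenfunctions of [q] *)

Section BackwardTransform.
Variables (l : R) (y : R -> R).
Hypothesis sy : rsol (fun x => q x + 2 * dsfun x) l y.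
Hypothesis yi : sq_int setT y.

Let y_continuous : continuous y.
Proof. by have [] := ode_sol_prim sy. Qed.

(** Under these hypotheses [M v] has derivative 0; its value [d] satisfies [y = d.t], and
    [posdef_cauchy] forces [d = 0]. The primitive [v] is arbitrary because [restored] applies this
    to two different ones. *)
Lemma tvec_dot_eq0 (v : R -> 'cV[R]_N) : mxprim (fun x => y x *: tvec x) v ->
  (forall x, y x = dot (evec x) (v x)) -> forall x, y x = 0.
Proof.
move=> pv yE.
have pMv : mxprim (fun=> 0) (fun x => Mmx x *m v x).
  apply: mxprim_ext (mxprimM mxprim_Mmx pv) => // x.
  by rewrite mulNmx outer_mulmx -scalemxAr mulmx_tvec yE addrC subrr.
pose d := Mmx 0 *m v 0.
have vE x : v x = invmx (Mmx x) *m d.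
  by rewrite /d (mxprim0_eq pMv 0 x) mulKmx ?Mmx_unit.
have {}yE x : y x = dot d (tvec x).
  by rewrite yE vE (dotC d) dotMl invmx_Mmx_tr.
have [Y [pY [K YK]]] := sq_int_prim y_continuous yi.
have pd : prim (fun t => y t ^+ 2) (fun x => dot d (invmx (Mmx x) *m d)).
  apply: prim_ext (prim_dot (mxprim_cst d) (mxprimM mxprim_invmx_Mmx (mxprim_cst d))) => // x.
  by rewrite dot0l add0r mulmx0 addr0 outer_mulmx dotZr (dotC (tvec x)) -yE expr2.
pose B := dot d (invmx (Mmx 0) *m d) + K.
have dB x : 0 <= x -> dot d (invmx (Mmx x) *m d) <= B.
  move=> x0; rewrite /B -lerBlDl; apply: (le_trans (prim_le pd pY x0 (fun t _ => lexx _))).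
  by rewrite lerBlDr; case/andP: (YK x) => _ /le_trans; apply; rewrite lerDl; case/andP: (YK 0).
have d0 : d = 0.
  apply/eqP; rewrite -dot_eq0 -sqrf_eq0 eq_le sqr_ge0 andbT.
  have lim0 : dot d (Mmx x *m d) * B @[x --> +oo] --> 0 * B.
    by apply: cvgM; [exact: cvgy_quad_Mmx|exact: cvg_cst].
  rewrite -(mul0r B) -(cvg_lim _ lim0)//; apply: limr_ge.
    by apply/cvg_ex; eexists; exact: lim0.
  near=> x; have x0 : 0 <= x by near: x; apply: nbhs_pinfty_ge; exact: num_real.
  apply: (le_trans (posdef_cauchy d (Mmx_posdef x) (Mmx_tr x))).
  by rewrite ler_wpM2l ?quad_Mmx_ge0 ?dB.
by move=> x; rewrite yE d0 dot0l.
Unshelve. all: by end_near. Qed.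

(** Where [lam i != l], the primitive is the Wronskian of [t_i] and [y] over [lam i - l]. Where
    [lam i = l], that Wronskian is constant: any primitive serves, and the constant is recorded in
    [c]. *)
Lemma tvec_wronskian_prim : exists (v : R -> 'cV[R]_N) (c : 'cV[R]_N),
  [/\ mxprim (fun x => y x *: tvec x) v,
    forall x, derive1 y x *: tvec x - y x *: dtvec x = Lmx *m v x - l *: v x + c &
    forall i, lam i != l -> c i 0 = 0].
Proof.
have [y1 y2 yc y'c] := ode_sol_prim sy.
pose w i x := derive1 y x * tvec x i 0 - y x * dtvec x i 0.
have pw i : prim (fun x => (lam i - l) * (y x * tvec x i 0)) (w i).
  apply: prim_ext (primB (primM y2 (mxprim_tvec i 0)) (primM y1 (mxprim_dtvec i 0))) => // x.
  have -> : ((q x + 2 * dsfun x) *: tvec x - Lmx *m tvec x) i 0 =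
      (q x + 2 * dsfun x) * tvec x i 0 - lam i * tvec x i 0.
    by rewrite [LHS]mxE [X in _ + X = _]mxE LmxE [X in X + _ = _]mxE.
  by ring.
have exv i : exists P, prim (fun x => y x * tvec x i 0) P.
  apply: prim_exists => a b; apply: continuous_integrable; apply: contM => //.
  exact: tvec_continuous.
have [P pP] : exists P : 'I_N -> R -> R, forall i, prim (fun x => y x * tvec x i 0) (P i).
  by have [P pP] := choice exv; exists P.
pose v x : 'cV[R]_N := \col_i (if lam i == l then P i x else w i x / (lam i - l)).
pose c : 'cV[R]_N := \col_i (if lam i == l then w i 0 else 0).
exists v, c; split.
- move=> i j; rewrite (ord1 j); case: (eqVneq (lam i) l) => il.
    by apply: prim_ext (pP i) => x; rewrite !mxE ?il ?eqxx.
  have l0 : lam i - l != 0 by rewrite subr_eq0.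
  apply: prim_ext (primZ (lam i - l)^-1 (pw i)) => x; first by rewrite !mxE; field.
  by rewrite !mxE (negbTE il) mulrC.
- move=> x; apply/matrixP => i j; rewrite (ord1 j).
  transitivity (w i x).
    by rewrite mxE [X in X + _ = _]mxE [X in _ + X = _]mxE [X in _ - X = _]mxE.
  transitivity ((lam i - l) * v x i 0 + c i 0); last first.
    rewrite [RHS]mxE [X in _ = X + _]mxE LmxE [X in _ = _ + X + _]mxE.
    by rewrite [X in _ = _ - X + _]mxE; ring.
  rewrite !mxE; case: (eqVneq (lam i) l) => il.
    rewrite il subrr mul0r add0r; apply: (@prim0_eq R (w i)).
    by apply: prim_ext (pw i) => // t; rewrite il subrr mul0r.
  by rewrite addr0 mulrC divfK// subr_eq0.
- by move=> i il; rewrite mxE (negbTE il).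
Qed.

Section Solution.
Variables (v : R -> 'cV[R]_N) (c : 'cV[R]_N).
Hypothesis pv : mxprim (fun x => y x *: tvec x) v.
Hypothesis vc : forall x,
  derive1 y x *: tvec x - y x *: dtvec x = Lmx *m v x - l *: v x + c.
Hypothesis cl : forall i, lam i != l -> c i 0 = 0.

Definition rsolu (x : R) : R := y x - dot (evec x) (v x).

Lemma rsolu_ode : ode_sol q rsolu (fun x => l * rsolu x + dot c (evec x)).
Proof.
have [y1 y2 yc y'c] := ode_sol_prim sy.
have p1 : prim (fun x => derive1 y x - dot (devec x) (v x) - y x * sfun x) rsolu.
  apply: prim_ext (primB y1 (prim_dot mxprim_evec pv)) => // x.
  by rewrite dotZr -/(sfun x); ring.
apply: (proj1 (ode_sol_intro p1 _)).
apply: prim_ext (primB (primB y2 (prim_dot mxprim_devec pv)) (primM y1 prim_sfun)) => // x.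
have LT : (Lmx^T = Lmx)%R by exact: tr_diag_mx.
have E : Lmx *m v x = l *: v x + (derive1 y x *: tvec x - y x *: dtvec x) - c.
  by rewrite vc addrA addrK addrCA subrr addr0.
have E1 : dot (Lmx *m evec x) (v x) = l * dot (evec x) (v x) + derive1 y x * sfun x
    - y x * dot (evec x) (dtvec x) - dot c (evec x).
  rewrite dotMl LT E (dotC c) /sfun; move: (dtvec x) (tvec x) => dt t.
  by rewrite !dotDr !dotNr !dotZr; ring.
by rewrite dotDl dotNl E1 dotZl dotZr /rsolu /dsfun; ring.
Qed.

Lemma rsolu_continuous : continuous rsolu.
Proof. by have [] := ode_sol_prim rsolu_ode. Qed.

Lemma prim_rsolu_sq Y : prim (fun t => y t ^+ 2) Y ->
  prim (fun t => rsolu t ^+ 2) (fun t => Y t - dot (v t) (Mmx t *m v t)).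
Proof.
move=> pY.
apply: prim_ext (primB pY (prim_dot pv (mxprimM mxprim_Mmx pv))) => // x.
rewrite mulNmx outer_mulmx -scalemxAr mulmx_tvec dotDr dotNr !dotZr !dotZl.
by rewrite -[Mmx x]Mmx_tr -dotMl mulmx_tvec (dotC (v x)) /rsolu; ring.
Qed.

(** The primitive is [Y - v.M v]. It is bounded above because [M] is positive. Towards -oo it is
    bounded below because [M <= 1] and [v] stays bounded: [|y t_i| <= t_i^2 + y^2], and [t_i^2] has
    the nonnegative primitive [(M^-1)_ii]. *)
Lemma rsolu_sq_int : sq_int setT rsolu.
Proof.
have [Y [pY [K YK]]] := sq_int_prim y_continuous yi.
have pU := prim_rsolu_sq pY.
have Und := prim_nondecreasing pU (fun t => sqr_ge0 _).
pose B i := `|v 0 i 0| + (invmx (Mmx 0) i i + K).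
have vB i x : x <= 0 -> `|v x i 0| <= B i.
  move=> x0; have := prim_norm_le (pv i 0) (primD (mxprim_invmx_Mmx i i) pY) x0.
  have Nx : 0 <= invmx (Mmx x) i i.
    have := posdef_ge0 (delta_mx i 0) (invmx_Mmx_posdef x).
    rewrite -colE /dot (bigD1 i)//= big1 => [|j ji]; last by rewrite mxE (negbTE ji) mul0r.
    by rewrite !mxE !eqxx mul1r addr0.
  have tE t : (tvec t *m (tvec t)^T) i i = tvec t i 0 ^+ 2.
    by rewrite mxE big_ord1 [X in _ * X]mxE expr2.
  have H t : x <= t <= 0 -> `|(y t *: tvec t) i 0| <= (tvec t *m (tvec t)^T) i i + y t ^+ 2.
    move=> _; rewrite tE mxE ler_norml.
    have := sqr_ge0 (y t - tvec t i 0); have := sqr_ge0 (y t + tvec t i 0).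
    by move=> *; apply/andP; split; nra.
  move=> /(_ H); have := YK 0; have := YK x; have := ler_normB (v 0 i 0) (v 0 i 0 - v x i 0).
  rewrite opprB addrC subrK /B; lra.
pose C := \sum_i B i ^+ 2.
have vC x : x <= 0 -> dot (v x) (Mmx x *m v x) <= C.
  move=> x0; apply: (le_trans (quad_Mmx_le _ _)); apply: ler_sum => i _.
  rewrite -expr2 -(real_normK (num_real (v x i 0))).
  by apply: lerXn2r; rewrite ?nnegrE ?vB// (le_trans _ (vB i x x0)).
apply: (prim_sq_int (K := K + C) rsolu_continuous pU) => a b ab.
(* The lower bound is known on the negative axis only; the primitive being nondecreasing, [a] may be
   lowered to [min a 0]. *)
have a0 : Num.min a 0 <= a by rewrite ge_min lexx.
have a0' : Num.min a 0 <= 0 by rewrite ge_min lexx orbT.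
have := Und _ _ a0; have := vC _ a0'; have := YK (Num.min a 0); have := YK b.
have := quad_Mmx_ge0 (v b) b; lra.
Qed.

(** It remains to see that [c = 0]. Since [c] lives on the indices with [lam i = l], the sum [W] of
    [c_i W(phi_i, rsolu)] has derivative [- (c.phi)^2], the same as [c.M c]. The difference
    [c.M c - W] is constant, equal to 0 at +oo and to [c.c] at -oo. *)
Lemma rsolu_rsol : rsol q l rsolu.
Proof.
suff c0 : c = 0.
  have := rsolu_ode; rewrite /rsol c0 (_ : (fun x => _ + dot 0 _) = fun t => l * rsolu t)//.
  by apply/funext => x; rewrite dot0l addr0.
have Fc : continuous (fun x => dot c (evec x)).
  by apply: cont_sum => i; apply: contM; [exact: cont_cst|exact: prim_continuous (mxprim_evec i 0)].
have Fi : sq_int setT (fun x => dot c (evec x)).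
  apply: sq_int_bigsum => i.
    by apply: contM; [exact: cont_cst|exact: prim_continuous (mxprim_evec i 0)].
  apply: sq_intZ; rewrite (_ : (fun t => _) = phi i)//.
  by apply/funext => t; rewrite mxE.
have rc := rsolu_continuous.
have Hc : continuous (fun x => l * rsolu x + dot c (evec x)) by cont.
have Hi : sq_int setT (fun x => l * rsolu x + dot c (evec x)).
  by apply: sq_intD => //; [cont|apply: sq_intZ; exact: rsolu_sq_int].
have W0 i := wronskian_phi_cvg0 i rsolu_ode Hc rsolu_sq_int Hi.
pose W x := \sum_i c i 0 * wronskian (phi i) rsolu x.
have pW : prim (fun t => - (dot c (evec t) ^+ 2)) W.
  have := prim_sum (index_enum _) (fun i => primZ (c i 0) (prim_wronskian (sphi i) rsolu_ode)).
  apply: prim_ext => // t.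
  transitivity (\sum_i - (c i 0 * evec t i 0 * dot c (evec t))).
    apply: eq_bigr => i _; rewrite mxE; case: (eqVneq (lam i) l) => [->|/cl ->]; ring.
  by rewrite sumrN -mulr_suml expr2.
have lim (F : set_system R) (FF : ProperFilter F) :
    (forall i, wronskian (phi i) rsolu x @[x --> F] --> 0) -> W x @[x --> F] --> 0.
  move=> WF; rewrite (_ : 0 = \sum_(i <- index_enum 'I_N) c i 0 * 0); last first.
    by rewrite big1// => i _; rewrite mulr0.
  by apply: cvg_bigsum => i; apply: cvgM; [exact: cvg_cst|exact: WF].
have p0 : prim (fun=> 0) (fun x => dot c (Mmx x *m c) - W x).
  by apply: prim_ext (primB (prim_quad_Mmx c) pW) => // t; rewrite subrr.
have ly : dot c (Mmx x *m c) - W x @[x --> +oo] --> (0 - 0 : R).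
  by apply: cvgB; [exact: cvgy_quad_Mmx|apply: lim => i; exact: (proj1 (W0 i))].
have lNy : dot c (Mmx x *m c) - W x @[x --> -oo] --> (dot c c - 0 : R).
  by apply: cvgB; [exact: cvgNy_quad_Mmx|apply: lim => i; exact: (proj2 (W0 i))].
apply/eqP; rewrite -dot_eq0 -[X in X == _]subr0.
by rewrite -(prim0_cvg p0 lNy 0) (prim0_cvg p0 ly 0) subr0.
Qed.

End Solution.

(** [y - phi.v] is nonzero, since [y = phi.v] is excluded by [tvec_dot_eq0]. If [lam n = l],
    simplicity makes it [k phi_n], so [y = phi.(v + k e_n)]; as [v + k e_n] is another primitive of
    [y t], this is excluded in the same way. *)
Lemma restored : (exists x, y x != 0) ->
  (forall n u, lam n = l -> eigenfun q l u -> exists k : R, u = (fun t => k * phi n t)) ->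
  is_eigenvalue q l /\ forall n, lam n != l.
Proof.
move=> [x0 yx0] simple.
have [v [c [pv vc cl]]] := tvec_wronskian_prim.
have su := rsolu_rsol pv vc cl; have ui := rsolu_sq_int pv vc.
have ynot v' : mxprim (fun x => y x *: tvec x) v' ->
    ~ (forall x, y x = dot (evec x) (v' x)).
  by move=> pv' /(tvec_dot_eq0 pv')/(_ x0)/eqP; apply/negP.
have [x ux] : exists x, rsolu v x != 0.
  apply/not_existsP => H; apply: (ynot v pv) => x; apply/eqP; rewrite -subr_eq0.
  by apply/negPn/negP; exact: H.
have eu : eigenfun q l (rsolu v) by split=> //; split=> //; exists x.
split; first by exists (rsolu v).
move=> n; apply/negP => /eqP nl; have [k uE] := simple n _ nl eu.
apply: (ynot (fun x => v x + k *: delta_mx n 0)).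
  by apply: mxprim_ext (mxprimD pv (mxprim_cst (k *: delta_mx n 0))) => // t; rewrite addr0.
move=> t; have := congr1 (fun f => f t) uE; rewrite /rsolu /= => E.
rewrite dotDr dotZr [X in k * X](_ : _ = phi n t); first by rewrite -E addrC subrK.
rewrite /dot (bigD1 n)//= big1 => [|j jn]; last by rewrite [X in _ * X]mxE (negbTE jn) mulr0.
by rewrite !mxE !eqxx mulr1 addr0.
Qed.

End BackwardTransform.

End Potential.

Theorem theorem4p1 (R : realType) (q : R -> R) (N : nat)
    (w : 'I_N -> R) (phi : 'I_N -> R -> R) :
  loc_integrable q ->
  semibounded_below q ->
  jost_exists_ae q ->
  (forall n, 0 < w n) ->
  (forall n, simple_eigenvalue q (w n ^+ 2)) ->
  (forall n, refl_cont_at q (w n)) ->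
  (forall n, jost_pole_cont_at q (w n)) ->
  (forall n, eigenfun q (w n ^+ 2) (phi n)) ->
  orthonormal_set phi ->
  embedded_eigenvalues (q_minusN q phi) =
    embedded_eigenvalues q `\` [set w n ^+ 2 | n in setT].
Proof.
move=> qi sb _ _ simple _ _ eig onphi.
have sphi n : rsol q (w n ^+ 2) (phi n) by have [] := eig n.
have iphi n : sq_int setT (phi n) by have [_ []] := eig n.
have phin0 n : exists x, phi n x != 0 by have [_ []] := eig n.
(* Two indices with the same simple eigenvalue would have proportional eigenfunctions, against
   orthonormality. *)
have lamI : injective (fun n => w n ^+ 2).
  move=> i j wij; apply/eqP/negPn/negP => ij.
  have [_ /(_ (phi i) (phi j) (eig i))] := simple i.
  rewrite wij => /(_ (eig j))[c phij].
  have := integ_phi onphi j j; rewrite eqxx => /eqP; apply/negP.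
  have -> : integ setT (fun t => phi j t * phi j t) =
      integ setT (fun t => c * (phi i t * phi j t)).
    by rewrite {1}phij; congr integ; apply/funext => t; rewrite mulrA.
  rewrite integE RintegralZl//; last exact: phi_integrable sphi iphi i j.
  by rewrite -integE (integ_phi onphi) (negbTE ij) mulr0 eq_sym oner_eq0.
rewrite (q_minusNE qi sb lamI sphi iphi phin0 onphi).
apply/seteqP; split=> l /=.
- move=> [l0 [y [sy [yi yn0]]]].
  have [|ev nl] := restored qi sb lamI sphi iphi phin0 onphi sy yi yn0.
    move=> n u nl eu; have [_ sn] := simple n.
    by apply: sn (eig n) _; rewrite nl.
  by split=> // -[n _ wl]; have := nl n; rewrite wl eqxx.
- move=> [[l0 [u [su [ui un0]]]] nl]; split=> //.
  have lamNl n : w n ^+ 2 != l by apply/negP => /eqP wl; apply: nl; exists n.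
  eexists; exact: (tsol_eigenfun qi sb lamI sphi iphi phin0 onphi lamNl su ui un0).
Qed.
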